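(* Let $M_t$, $t\in[0,T)$, be a family of smooth closed strictly convex surfaces in $\mathbb{R}^3$ flowing according to $\frac{d}{dt}X=-(\operatorname{tr}A^3)\nu$. Then $$\max_{M_t}\frac{(3\lambda_1^2+2\lambda_1\lambda_2+3\lambda_2^2)(\lambda_1-\lambda_2)^2}{\lambda_1\lambda_2}$$ is non-increasing in time.
   Context: A closed surface is a compact connected embedded surface without boundary. $X=X(x,t)$ is the (smooth) embedding vector of $M_t$ into $\mathbb{R}^3$, $\frac{d}{dt}X$ its total time derivative, and $\nu$ the outer unit normal to $M_t$. The principal curvatures $\lambda_1,\lambda_2$ are the eigenvalues of the second fundamental form with respect to the induced metric, with sign such that round spheres have positive principal curvatures. A surface is strictly convex if all its principal curvatures are strictly positive. $\operatorname{tr}A^3=\lambda_1^3+\lambda_2^3$. *)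

(* Defs.v *)
From HB Require Import structures.
From mathcomp Require Import all_boot all_order all_algebra.
From mathcomp Require Import all_classical all_reals all_analysis.

Set Implicit Arguments.
Unset Strict Implicit.
Unset Printing Implicit Defensive.

Import Order.TTheory GRing.Theory Num.Theory.
Import numFieldNormedType.Exports.

Local Open Scope classical_set_scope.
Local Open Scope ring_scope.

Section Smooth.
Context {R : realType} {V W : normedModType R}.

(* Only used for open [O]: the values of ['D_v f] at a point of [O] then
   depend on [f] on [O] only. *)
Fixpoint Ck_on (k : nat) (O : set V) (f : V -> W) : Prop :=
  (forall x, O x -> {for x, continuous f}) /\
  (if k is k'.+1 then
     forall v : V, (forall x, O x -> derivable f x v) /\ Ck_on k' O ('D_v f)
   else True).

Definition smooth_on (O : set V) (f : V -> W) : Prop := forall k, Ck_on k O f.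

(* Smoothness on an arbitrary subset such as [0, T) x U: locally, [f] is the
   restriction of a function that is smooth on an open set. *)
Definition smooth_within (A : set V) (f : V -> W) : Prop :=
  forall x, A x -> exists (O : set V) (g : V -> W),
    [/\ open O, O x, smooth_on O g & forall y, (A `&` O) y -> g y = f y].

End Smooth.

Section Surface.
Context {R : realType}.

(* The chart [i] is given by its local parametrization [par i], a
   homeomorphism from the open set [dom i] onto an open subset of [M], with
   inverse [coord i]; the values outside of these sets are irrelevant. *)
Record surface_atlas (M : topologicalType) := SurfaceAtlas {
  idx : Type;
  dom : idx -> set 'rV[R]_2;
  par : idx -> 'rV[R]_2 -> M;
  coord : idx -> M -> 'rV[R]_2;
  dom_open : forall i, open (dom i);
  img_open : forall i, open (par i @` dom i);
  par_continuous : forall i u, dom i u -> {for u, continuous (par i)};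
  coord_continuous : forall i p, (par i @` dom i) p ->
    {for p, continuous (coord i)};
  parK : forall i u, dom i u -> coord i (par i u) = u;
  atlas_cover : forall p, exists i, (par i @` dom i) p;
  atlas_smooth : forall i j,
    smooth_on (dom i `&` par i @^-1` (par j @` dom j)) (coord j \o par i)
}.

(* To be used on a surface, i.e. together with a [surface_atlas]: such an
   [M] has no boundary. *)
Definition closed_surface (M : topologicalType) : Prop :=
  [/\ [set: M] !=set0, hausdorff_space M, compact [set: M]
    & connected [set: M]].

Definition dot (n : nat) (v w : 'rV[R]_n) : R := \sum_(i < n) v 0 i * w 0 i.

Definition partial (a : 'I_2) (F : 'rV[R]_2 -> 'rV[R]_3) : 'rV[R]_2 -> 'rV[R]_3 :=
  'D_(delta_mx 0 a) F.

Definition jacobian_mx (F : 'rV[R]_2 -> 'rV[R]_3) (u : 'rV[R]_2) : 'M[R]_(2, 3) :=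
  \matrix_(a < 2) partial a F u.

Definition first_form (F : 'rV[R]_2 -> 'rV[R]_3) (u : 'rV[R]_2) : 'M[R]_2 :=
  \matrix_(a < 2, b < 2) dot (partial a F u) (partial b F u).

(* With [n] the outer unit normal, the minus sign makes the second fundamental
   form of round spheres positive definite. *)
Definition second_form (F : 'rV[R]_2 -> 'rV[R]_3) (n : 'rV[R]_3) (u : 'rV[R]_2) :
    'M[R]_2 :=
  \matrix_(a < 2, b < 2) - dot (partial a (partial b F) u) n.

Definition exterior (K : set 'rV[R]_3) : set 'rV[R]_3 :=
  [set x | (~` K) x /\ ~ bounded_set (connected_component (~` K) x)].

Section Embedded.
Context {M : topologicalType} (A : surface_atlas M).

(* As [M] is compact, an injective immersion is an embedding. *)
Definition embedding (X : M -> 'rV[R]_3) : Prop :=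
  injective X /\
  forall (i : idx A) u, dom i u -> row_free (jacobian_mx (X \o par i) u).

Definition outer_unit_normal (X : M -> 'rV[R]_3) (p : M) (n : 'rV[R]_3) : Prop :=
  [/\ dot n n = 1,
      forall (i : idx A) u, dom i u -> par i u = p ->
        forall a, dot n (partial a (X \o par i) u) = 0
    & \forall s \near 0^'+, exterior (range X) (X p + s *: n)].

(* [l1] and [l2] are the eigenvalues, with multiplicity, of the second
   fundamental form (w.r.t. the normal [n]) relative to the induced metric. *)
Definition principal_curvatures (X : M -> 'rV[R]_3) (p : M) (n : 'rV[R]_3)
    (l1 l2 : R) : Prop :=
  forall (i : idx A) u, dom i u -> par i u = p ->
    char_poly (invmx (first_form (X \o par i) u) *m
               second_form (X \o par i) n u)
    = ('X - l1%:P) * ('X - l2%:P).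

(* [0, T), with T = +oo allowed *)
Definition times (T : \bar R) : set R := [set t | 0 <= t /\ (t%:E < T)%E].

Definition smooth_family (T : \bar R) (X : R -> M -> 'rV[R]_3) : Prop :=
  forall i : idx A, smooth_within
    [set z : R * 'rV[R]_2 | times T z.1 /\ dom i z.2]
    (fun z => X z.1 (par i z.2)).

End Embedded.

(* [v] is the derivative at [t] of a curve defined on [0, T); it is one-sided
   for t = 0. *)
Definition is_time_derivative (T : \bar R) (c : R -> 'rV[R]_3) (t : R)
    (v : 'rV[R]_3) : Prop :=
  (fun h : R => h^-1 *: (c (t + h) - c t))
    @ within [set h | times T (t + h)] 0^' --> v.

Definition is_max (M : Type) (f : M -> R) (m : R) : Prop :=
  (exists p, f p = m) /\ forall p, f p <= m.

Definition pinching (l1 l2 : R) : R :=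
  (3 * l1 ^+ 2 + 2 * l1 * l2 + 3 * l2 ^+ 2) * (l1 - l2) ^+ 2 / (l1 * l2).

End Surface.

Arguments surface_atlas R M : clear implicits.

(* Main.v *)
Require Import Defs.
From HB Require Import structures.
From mathcomp Require Import all_boot all_order all_algebra.
From mathcomp Require Import all_classical all_reals all_analysis.
From mathcomp Require Import ring lra.
Import Order.TTheory GRing.Theory Num.Theory.
Import numFieldNormedType.Exports.
Local Open Scope classical_set_scope.
Local Open Scope ring_scope.

Set Implicit Arguments.
Unset Strict Implicit.
Unset Printing Implicit Defensive.

(** Let [w] be the pinching quantity, [H = l1 + l2] and [K = l1 l2]. Then
    [w = (3 H^2 - 4 K) (H^2 - 4 K) / K], so that [w] is a smooth function of the
    first and second derivatives of the surface, at umbilics as well.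

    Its monotonicity is a maximum principle ([maximum_principle]). If [w]
    increased somewhere, then [w - eps t] would, for a small [eps > 0], have its
    maximum over [s <= r <= t] and the compact surface at a time [r > s], where
    the time derivative of [w] would be at least [eps]. So it suffices that this
    derivative is nonpositive at a spatial maximum of [w] at a positive time,
    and that [w] is continuous up to the initial time.

    For the derivative, write the surface near the maximum as a graph [z] over
    its tangent plane, with axes in the principal directions. With
    [D = 1 + z_x^2 + z_y^2],
    [P = (1 + z_y^2) z_xx - 2 z_x z_y z_xy + (1 + z_x^2) z_yy]
    and [Q = z_xx z_yy - z_xy^2] one has [K = Q / D^2] and, up to the
    sign fixed by the normal, [H = P / D^(3/2)]; the flow becomes
    [z_t = (P^3 - 3 P Q D) / D^4]. Let [l] and [m] be the values of [z_xx] and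
    [z_yy] at the origin. When [w_t - 3 l^2 w_xx - 3 m^2 w_yy] is expanded at the
    origin, the fourth derivatives of [z] cancel. What remains is
    [- 2 (l - m)^2 (l^4 - 2 l^3 m + 18 l^2 m^2 - 2 l m^3 + m^4)] and two quadratic
    forms in the third derivatives, which are nonpositive on the solutions of
    [w_x = w_y = 0] ([grad_form_le0]). As [w_xx] and [w_yy] are nonpositive at a
    maximum, so is [w_t] ([graph_max_le0]).

    The graph is never constructed. Choose orthonormal coordinates [x, y, z] of
    space adapted to the maximum and regard them as functions of time and of the
    parameters of a chart. The partial derivatives with respect to [x], [y] and
    to time at fixed [x, y] are then combinations of the derivatives in the
    chart, and they commute ([dXYC], [dTXC], [dTYC]). The computation thus takes
    place in a commutative ring with three commuting derivations and an evaluation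
    at a point, here the smooth functions on a neighbourhood of the maximum
    ([smooth_fun]), on which partial derivatives commute by the theorem of Schwarz
    ([deriveC]).

    The normal enters only through even expressions: [w] is even in it, and so is
    the velocity, a product of two odd factors. In a chart it can therefore be
    replaced by the cross product of the two tangent vectors, which is the unit
    normal up to the factor [+ sqrt D] or [- sqrt D], where [D] is the Gram
    determinant of the chart; the flow and [w] become rational in the derivatives
    of the surface ([curvature_forms]). *)

(** * Derivations of a commutative ring *)

Record derivation (A : comPzRingType) := Derivation {
  der :> A -> A;
  derD : forall a b, der (a + b) = der a + der b;
  derM : forall a b, der (a * b) = der a * b + a * der b }.

Section DerivationTheory.
Variables (A : comPzRingType) (d : derivation A).
Implicit Types a b : A.

Lemma der0 : d 0 = 0.
Proof. by apply: (addrI (d 0)); rewrite -derD !addr0. Qed.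

Lemma derN a : d (- a) = - d a.
Proof. by apply: (addrI (d a)); rewrite -derD !subrr der0. Qed.

Lemma derB a b : d (a - b) = d a - d b.
Proof. by rewrite derD derN. Qed.

Lemma der1 : d 1 = 0.
Proof.
have := derM d 1 1; rewrite mulr1 mul1r => /eqP.
by rewrite mulr1 -subr_eq0 opprD addrA subrr add0r oppr_eq0 => /eqP.
Qed.

Lemma derMn a n : d (a *+ n) = d a *+ n.
Proof. by elim: n => [|n IHn]; rewrite ?der0 // !mulrS derD IHn. Qed.

Lemma der_nat n : d n%:R = 0.
Proof. by rewrite derMn der1 mul0rn. Qed.

Lemma derX a n : d (a ^+ n.+1) = n.+1%:R * a ^+ n * d a.
Proof.
elim: n => [|n IHn]; first by rewrite expr1 expr0 !mul1r.
by rewrite exprS derM IHn (_ : n.+2%:R = n.+1%:R + 1) ?exprS; [ring|rewrite -natr1].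
Qed.

Lemma der_inv a i : i * a = 1 -> d i = - (i ^+ 2 * d a).
Proof.
move=> ia; have : d (i * a) = 0 by rewrite ia der1.
rewrite derM => h.
have -> : d i = i * (d i * a) by rewrite mulrC -mulrA (mulrC a) ia mulr1.
have -> : d i * a = - (i * d a) by apply/eqP; rewrite -addr_eq0 h.
by ring.
Qed.

Definition derE := (derD, derB, derN, derM, derX, der1, der0, der_nat).

End DerivationTheory.

Section Combination.
Variables (A : comPzRingType) (d1 d2 : derivation A) (a b : A).

Lemma der_combD f g : a * d1 (f + g) + b * d2 (f + g) =
  (a * d1 f + b * d2 f) + (a * d1 g + b * d2 g).
Proof. by rewrite !derD; ring. Qed.

Lemma der_combM f g : a * d1 (f * g) + b * d2 (f * g) =
  (a * d1 f + b * d2 f) * g + f * (a * d1 g + b * d2 g).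
Proof. by rewrite !derM; ring. Qed.

Definition der_comb := Derivation der_combD der_combM.
End Combination.

Section Speed.
Variable A : comPzRingType.
Implicit Types P Q D i k : A.

(** The vertical velocity of a graph, the normal velocity times [sqrt D]. Here and
    below [i] and [k] stand for the inverses of [D] and [Q]. *)
Definition speed P Q D i : A := (P ^+ 3 - 3 * P * Q * D) * i ^+ 4.
(** The pinching quantity. It does not change when [P], [Q], [D] are replaced by
    [J^3 P], [J^4 Q], [J^2 D], which is what a change of parameters with Jacobian
    [J] does to them. *)
Definition pinch P Q D i k : A :=
  (3 * P ^+ 2 - 4 * Q * D) * (P ^+ 2 - 4 * Q * D) * i ^+ 4 * k.
End Speed.

Section Jets.
Variables (A : comPzRingType) (R : realFieldType) (ev : {rmorphism A -> R}).
Variable d : derivation A.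
Implicit Types a b : A.

Lemma ev_d_M a b : ev (d (a * b)) = ev (d a) * ev b + ev a * ev (d b).
Proof. by rewrite derM rmorphD !rmorphM. Qed.

Lemma ev_d_X a n : ev (d (a ^+ n.+1)) = n.+1%:R * ev a ^+ n * ev (d a).
Proof. by rewrite derX !rmorphM rmorphXn rmorph_nat. Qed.

Lemma ev_d_D a b : ev (d (a + b)) = ev (d a) + ev (d b).
Proof. by rewrite derD rmorphD. Qed.

Lemma ev_d_N a : ev (d (- a)) = - ev (d a).
Proof. by rewrite derN rmorphN. Qed.

Lemma ev_d_nat n : ev (d n%:R) = 0.
Proof. by rewrite der_nat rmorph0. Qed.

Lemma ev_dd_M a b : ev (d (d (a * b))) =
  ev (d (d a)) * ev b + 2 * ev (d a) * ev (d b) + ev a * ev (d (d b)).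
Proof. by rewrite derM ev_d_D !ev_d_M; ring. Qed.

Lemma ev_dd_X a n : ev (d (d (a ^+ n.+2))) =
  n.+2%:R * n.+1%:R * ev a ^+ n * ev (d a) ^+ 2
  + n.+2%:R * ev a ^+ n.+1 * ev (d (d a)).
Proof. by rewrite derX ev_d_M ev_d_M ev_d_nat ev_d_X rmorphM rmorphXn rmorph_nat; ring. Qed.

Lemma ev_dd_D a b : ev (d (d (a + b))) = ev (d (d a)) + ev (d (d b)).
Proof. by rewrite derD ev_d_D. Qed.

Lemma ev_dd_N a : ev (d (d (- a))) = - ev (d (d a)).
Proof. by rewrite derN ev_d_N. Qed.

Lemma ev_dd_nat n : ev (d (d n%:R)) = 0.
Proof. by rewrite der_nat der0 rmorph0. Qed.

(** Evaluates the derivatives up to order two of a polynomial expression while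
    expanding them, so that factors vanishing at the point disappear at once. *)
Definition ev_jet := (ev_dd_D, ev_dd_N, ev_dd_M, ev_dd_X, ev_dd_nat,
  ev_d_D, ev_d_N, ev_d_M, ev_d_X, ev_d_nat,
  rmorphD, rmorphN, rmorphM, rmorphXn, rmorph_nat).

Lemma ev_inv a i : i * a = 1 -> ev a != 0 /\ ev i = (ev a)^-1.
Proof.
move=> /(congr1 ev); rewrite rmorphM rmorph1 => h.
have a0 : ev a != 0.
  by apply: contra_eq_neq h => ->; rewrite mulr0 eq_sym oner_eq0.
by split; rewrite // -[LHS]mulr1 -(mulfV a0) mulrA h mul1r.
Qed.

Lemma ev_d_inv a i : i * a = 1 -> ev (d i) = - ev (d a) / ev a ^+ 2.
Proof.
move=> ia; have [a0 evi] := ev_inv ia.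
by rewrite (der_inv d ia) rmorphN rmorphM rmorphXn evi; field.
Qed.

Lemma ev_dd_inv a i : i * a = 1 -> ev (d (d i)) =
  2 * ev (d a) ^+ 2 / ev a ^+ 3 - ev (d (d a)) / ev a ^+ 2.
Proof.
move=> ia; have [a0 evi] := ev_inv ia.
by rewrite (der_inv d ia) ev_d_N ev_d_M ev_d_X (ev_d_inv ia) rmorphXn evi; field.
Qed.

End Jets.

Section AtPoint.
Variables (A : comPzRingType) (R : realFieldType) (ev : {rmorphism A -> R}).
Variables (d : derivation A) (P Q D i k : A).
Hypotheses (iD : i * D = 1) (kQ : k * Q = 1).
(* The tangent plane of the graph is horizontal at the point. *)
Hypotheses (evD : ev D = 1) (evdD : ev (d D) = 0).

Let evi : ev i = 1.
Proof. by case: (ev_inv ev iD) => _ ->; rewrite evD invr1. Qed.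

Let evdi : ev (d i) = 0.
Proof. by rewrite (ev_d_inv ev d iD) evdD oppr0 mul0r. Qed.

Let evddi : ev (d (d i)) = - ev (d (d D)).
Proof. by rewrite (ev_dd_inv ev d iD) evD evdD; field. Qed.

Let Q0 : ev Q != 0.
Proof. by case: (ev_inv ev kQ). Qed.

Let evk : ev k = (ev Q)^-1.
Proof. by case: (ev_inv ev kQ). Qed.

Lemma ev_dd_speed :
  ev (d (d (speed P Q D i))) =
  (3 * ev P ^+ 2 - 3 * ev Q) * ev (d (d P)) - 3 * ev P * ev (d (d Q))
  + 6 * ev P * ev (d P) ^+ 2 - 6 * ev (d P) * ev (d Q)
  + (9 * ev P * ev Q - 4 * ev P ^+ 3) * ev (d (d D)).
Proof. by rewrite /speed !ev_jet evddi evdi evi evD evdD; ring. Qed.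

Let pinchE : pinch P Q D i k =
  3 * P ^+ 4 * k * i ^+ 4 - 16 * P ^+ 2 * i ^+ 3 + 16 * Q * i ^+ 2.
Proof. by rewrite /pinch; ring: iD kQ. Qed.

Lemma ev_d_pinch :
  ev (d (pinch P Q D i k)) =
  (12 * ev P ^+ 3 / ev Q - 32 * ev P) * ev (d P)
  + (16 - 3 * ev P ^+ 4 / ev Q ^+ 2) * ev (d Q).
Proof.
by rewrite pinchE !ev_jet evi evdi evk (ev_d_inv ev d kQ); field.
Qed.

Lemma ev_dd_pinch :
  ev (d (d (pinch P Q D i k))) =
  (12 * ev P ^+ 3 / ev Q - 32 * ev P) * ev (d (d P))
  + (16 - 3 * ev P ^+ 4 / ev Q ^+ 2) * ev (d (d Q))
  + (36 * ev P ^+ 2 / ev Q - 32) * ev (d P) ^+ 2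
  - 24 * ev P ^+ 3 / ev Q ^+ 2 * ev (d P) * ev (d Q)
  + 6 * ev P ^+ 4 / ev Q ^+ 3 * ev (d Q) ^+ 2
  + (48 * ev P ^+ 2 - 32 * ev Q - 12 * ev P ^+ 4 / ev Q) * ev (d (d D)).
Proof.
rewrite pinchE !ev_jet evddi evi evdi evk.
by rewrite (ev_dd_inv ev d kQ) (ev_d_inv ev d kQ); field.
Qed.
End AtPoint.

(** * The pinching inequality between derivatives at a point *)

Section Pointwise.
Variable R : realFieldType.
Implicit Types l m a b c d : R.

(** The partial derivatives of the pinching quantity in [P] and in [Q], at
    [D = 1]. *)
Definition pinch_P (P Q : R) := 12 * P ^+ 3 / Q - 32 * P.
Definition pinch_Q (P Q : R) := 16 - 3 * P ^+ 4 / Q ^+ 2.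

(** The second derivatives of the speed and of the pinching quantity in some
    direction, at a point where [D = 1] has a vanishing derivative: [P1], [Q1] are
    the first and [P2], [Q2], [D2] the second derivatives of [P], [Q], [D]. *)
Definition speed_2 (P Q P1 Q1 P2 Q2 D2 : R) :=
  (3 * P ^+ 2 - 3 * Q) * P2 - 3 * P * Q2
  + 6 * P * P1 ^+ 2 - 6 * P1 * Q1 + (9 * P * Q - 4 * P ^+ 3) * D2.

Definition pinch_2 (P Q P1 Q1 P2 Q2 D2 : R) :=
  pinch_P P Q * P2 + pinch_Q P Q * Q2
  + (36 * P ^+ 2 / Q - 32) * P1 ^+ 2
  - 24 * P ^+ 3 / Q ^+ 2 * P1 * Q1 + 6 * P ^+ 4 / Q ^+ 3 * Q1 ^+ 2
  + (48 * P ^+ 2 - 32 * Q - 12 * P ^+ 4 / Q) * D2.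

(** Up to the factor [(l - m) / (l^2 m)], the derivative of the pinching quantity
    in the principal curvature [l]. *)
Definition pinch_slope l m := 9 * l ^+ 3 + l ^+ 2 * m + 3 * l * m ^+ 2 + 3 * m ^+ 3.

Lemma pinch_slope_gt0 l m : 0 < l * m -> 0 < m * pinch_slope l m.
Proof.
move=> lm; have m0 : 0 < m ^+ 2.
  by rewrite exprn_even_gt0 //=; apply: contraTneq lm => ->; rewrite mulr0 ltxx.
rewrite (_ : m * pinch_slope l m = 9 * (l * m) * l ^+ 2 + (l * m) ^+ 2
  + 3 * (l * m) * m ^+ 2 + 3 * (m ^+ 2) ^+ 2); last by rewrite /pinch_slope; ring.
have := sqr_ge0 l; have := sqr_ge0 (l * m).
move: (l * m) (m ^+ 2) (l ^+ 2) lm m0 => q y x q0 y0 _ x0; nra.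
Qed.

(** The contribution of the third derivatives [a = z_xxx] and [c = z_xyy] to
    [w_t - 3 l^2 w_xx - 3 m^2 w_yy]. By symmetry [z_yyy] and [z_xxy] contribute the
    same form with [l] and [m] exchanged. *)
Definition grad_form l m a c : R :=
  let P := l + m in let Q := l * m in
  (pinch_P P Q + m * pinch_Q P Q) *
    (6 * P * (a + c) ^+ 2 - 6 * (a + c) * (a * m + l * c) - 6 * P * a * c)
  + 6 * (pinch_P P Q + l * pinch_Q P Q) * P * c ^+ 2
  - 3 * l ^+ 2 * (2 * pinch_Q P Q * a * c + (36 * P ^+ 2 / Q - 32) * (a + c) ^+ 2
     - 24 * P ^+ 3 / Q ^+ 2 * (a + c) * (a * m + l * c)
     + 6 * P ^+ 4 / Q ^+ 3 * (a * m + l * c) ^+ 2)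
  + 6 * m ^+ 2 * pinch_Q P Q * c ^+ 2.

(** The last hypothesis is [w_x = 0]. It leaves a line of pairs [(a, c)], and
    on this line the form is a negative multiple of the square of the parameter
    [t]. *)
Lemma grad_form_le0 l m a c : 0 < l * m -> l != m ->
  (pinch_P (l + m) (l * m) + m * pinch_Q (l + m) (l * m)) * a
  + (pinch_P (l + m) (l * m) + l * pinch_Q (l + m) (l * m)) * c = 0 ->
  grad_form l m a c <= 0.
Proof.
move=> lm lneqm.
have l0 : l != 0 by apply: contraTneq lm => ->; rewrite mul0r ltxx.
have m0 : m != 0 by apply: contraTneq lm => ->; rewrite mulr0 ltxx.
have d0 : l - m != 0 by rewrite subr_eq0.
have /lt0r_neq0 := pinch_slope_gt0 lm; rewrite mulf_eq0 negb_or m0 /= => slope0.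
have -> : pinch_P (l + m) (l * m) + m * pinch_Q (l + m) (l * m) =
    (l - m) * pinch_slope l m / (l ^+ 2 * m).
  by rewrite /pinch_P /pinch_Q /pinch_slope; field; rewrite l0 m0.
have -> : pinch_P (l + m) (l * m) + l * pinch_Q (l + m) (l * m) =
    - ((l - m) * pinch_slope m l / (l * m ^+ 2)).
  by rewrite /pinch_P /pinch_Q /pinch_slope; field; rewrite l0 m0.
move=> h.
(* The factor l - m is cancelled here. *)
have {}h : m * pinch_slope l m * a = l * pinch_slope m l * c.
  apply/eqP; rewrite -subr_eq0; apply/eqP.
  rewrite (_ : _ - _ = ((l - m) * pinch_slope l m / (l ^+ 2 * m) * a -
      (l - m) * pinch_slope m l / (l * m ^+ 2) * c) * ((l * m) ^+ 2 / (l - m))).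
    by rewrite -mulNr h mul0r.
  by field; rewrite l0 m0 d0.
have [t ct] : exists t, c = m * pinch_slope l m * t.
  by exists (c / (m * pinch_slope l m)); rewrite mulrC divfK // mulf_neq0.
have at_ : a = l * pinch_slope m l * t.
  apply: (@mulfI _ (m * pinch_slope l m)); first by rewrite mulf_neq0.
  by rewrite h ct; ring.
have l2 : 0 < l ^+ 2 by rewrite exprn_even_gt0.
rewrite {}ct {}at_.
(* In the polynomial of degree 12 only the coefficient of l^10 m^2 is negative;
   completing a square absorbs it in those of l^11 m and l^9 m^3. *)
rewrite (_ : grad_form _ _ _ _ = - ((t / l) ^+ 2 *
  (324 * m ^+ 12 + 810 * (l * m * m ^+ 10) + 810 * ((l * m) ^+ 2 * m ^+ 8)
  + 5670 * ((l * m) ^+ 3 * m ^+ 6) + 5130 * ((l * m) ^+ 4 * m ^+ 4)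
  + 3492 * ((l * m) ^+ 5 * m ^+ 2) + 13764 * (l * m) ^+ 6
  + 7308 * ((l * m) ^+ 5 * l ^+ 2) + 216 * ((l * m) ^+ 4 * l ^+ 4)
  + 6 * (l * m * l ^+ 8 *
    (33 * l ^+ 2 + 348 * (l - 2 * m) ^+ 2 + 3 * (l * m) + 1491 * m ^+ 2))
  + 378 * l ^+ 12))); last first.
  by rewrite /grad_form /pinch_P /pinch_Q /pinch_slope; field; rewrite l0 m0.
rewrite oppr_le0; apply: mulr_ge0; first exact: sqr_ge0.
have q0 : 0 <= l * m by exact: ltW.
have ev n x : 0 <= (x : R) ^+ n.*2 by rewrite exprn_even_ge0 // odd_double.
have qe j n x : 0 <= (l * m) ^+ j * (x : R) ^+ n.*2.
  exact: mulr_ge0 (exprn_ge0 _ q0) (ev n x).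
have h0 : 0 <= l * m * l ^+ 8 *
    (33 * l ^+ 2 + 348 * (l - 2 * m) ^+ 2 + 3 * (l * m) + 1491 * m ^+ 2).
  apply: mulr_ge0; first exact: (qe 1%N 4%N l).
  have := (ev 1%N l, ev 1%N m, ev 1%N (l - 2 * m)); rewrite /= => -[[]].
  by move: (l ^+ 2) (m ^+ 2) ((l - 2 * m) ^+ 2) (l * m) q0 => *; lra.
have k0 : 0 <= m ^+ 12 := ev 6%N m.
have k1 : 0 <= l * m * m ^+ 10 := qe 1%N 5%N m.
have k2 : 0 <= (l * m) ^+ 2 * m ^+ 8 := qe 2%N 4%N m.
have k3 : 0 <= (l * m) ^+ 3 * m ^+ 6 := qe 3%N 3%N m.
have k4 : 0 <= (l * m) ^+ 4 * m ^+ 4 := qe 4%N 2%N m.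
have k5 : 0 <= (l * m) ^+ 5 * m ^+ 2 := qe 5%N 1%N m.
have k6 : 0 <= (l * m) ^+ 6 := exprn_ge0 6 q0.
have k7 : 0 <= (l * m) ^+ 5 * l ^+ 2 := qe 5%N 1%N l.
have k8 : 0 <= (l * m) ^+ 4 * l ^+ 4 := qe 4%N 2%N l.
have k9 : 0 <= l ^+ 12 := ev 6%N l.
have nn n x : 0 <= x -> 0 <= n%:R * (x : R) by move=> ?; rewrite mulr_ge0.
by repeat apply: addr_ge0; try apply: nn.
Qed.

(** The fourth derivatives [z40], [z22], [z04] of the graph enter [w_t] through the
    Hessian of the speed, and they enter [3 l^2 w_xx + 3 m^2 w_yy], where [3 l^2]
    and [3 m^2] are the derivatives of the speed in [l] and [m], in the same way.
    After they have cancelled, a multiple of [(l - m)^2] and the two gradient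
    forms remain. *)
Lemma pinch_evolution_le0 l m a b c d z40 z22 z04 : 0 < l * m ->
  let P := l + m in let Q := l * m in
  let Px := a + c in let Py := b + d in
  let Qx := a * m + l * c in let Qy := b * m + l * d in
  let Pxx := z40 + z22 + 2 * l ^+ 2 * m in
  let Pyy := z22 + z04 + 2 * m ^+ 2 * l in
  let Qxx := z40 * m + l * z22 + 2 * a * c - 2 * b ^+ 2 in
  let Qyy := z22 * m + l * z04 + 2 * b * d - 2 * c ^+ 2 in
  let fxx := speed_2 P Q Px Qx Pxx Qxx (2 * l ^+ 2) in
  let fyy := speed_2 P Q Py Qy Pyy Qyy (2 * m ^+ 2) in
  pinch_P P Q * Px + pinch_Q P Q * Qx = 0 ->
  pinch_P P Q * Py + pinch_Q P Q * Qy = 0 ->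
  pinch_2 P Q Px Qx Pxx Qxx (2 * l ^+ 2) <= 0 ->
  pinch_2 P Q Py Qy Pyy Qyy (2 * m ^+ 2) <= 0 ->
  pinch_P P Q * (fxx + fyy) + pinch_Q P Q * (m * fxx + l * fyy) <= 0.
Proof.
move=> lm P Q Px Py Qx Qy Pxx Pyy Qxx Qyy fxx fyy wx wy wxx wyy.
have l0 : l != 0 by apply: contraTneq lm => ->; rewrite mul0r ltxx.
have m0 : m != 0 by apply: contraTneq lm => ->; rewrite mulr0 ltxx.
(* At an umbilic the differential of w in the second derivatives vanishes. *)
have [lm_eq|lneqm] := eqVneq l m.
  rewrite le_eqVlt; apply/orP; left; apply/eqP.
  have e : pinch_P P Q = - (l * pinch_Q P Q).
    by rewrite /P /Q -lm_eq /pinch_P /pinch_Q; field.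
  by rewrite e -lm_eq; ring.
have -> : pinch_P P Q * (fxx + fyy) + pinch_Q P Q * (m * fxx + l * fyy) =
  3 * l ^+ 2 * pinch_2 P Q Px Qx Pxx Qxx (2 * l ^+ 2)
  + 3 * m ^+ 2 * pinch_2 P Q Py Qy Pyy Qyy (2 * m ^+ 2)
  + grad_form l m a c + grad_form m l d b
  - 2 * (l - m) ^+ 2 * ((l ^+ 2 - l * m) ^+ 2 + (m ^+ 2 - l * m) ^+ 2 + (4 * l * m) ^+ 2).
  rewrite /fxx /fyy /speed_2 /pinch_2 /grad_form (addrC m l) (mulrC m l).
  rewrite /Px /Py /Qx /Qy /Pxx /Pyy /Qxx /Qyy -/P -/Q.
  rewrite /pinch_P /pinch_Q /P /Q; field.
  by rewrite l0 m0.
have g1 : grad_form l m a c <= 0.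
  by apply: grad_form_le0; rewrite // -wx /P /Q /Px /Qx; ring.
have g2 : grad_form m l d b <= 0.
  apply: grad_form_le0; rewrite 1?mulrC // 1?eq_sym //.
  by rewrite -wy /P /Q /Py /Qy (addrC m l) (mulrC m l); ring.
have l2 : 0 <= 3 * l ^+ 2 by rewrite mulr_ge0 ?sqr_ge0.
have m2 : 0 <= 3 * m ^+ 2 by rewrite mulr_ge0 ?sqr_ge0.
have h1 := mulr_ge0_le0 l2 wxx; have h2 := mulr_ge0_le0 m2 wyy.
have h3 : 0 <= 2 * (l - m) ^+ 2 *
    ((l ^+ 2 - l * m) ^+ 2 + (m ^+ 2 - l * m) ^+ 2 + (4 * l * m) ^+ 2).
  apply: mulr_ge0; first by rewrite mulr_ge0 ?sqr_ge0.
  by rewrite !addr_ge0 ?sqr_ge0.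
rewrite subr_le0 (le_trans _ h3) //.
by apply: (le_trans (lerD (lerD (lerD h1 h2) g1) g2)); rewrite !addr0.
Qed.

End Pointwise.

(** * Evolution of a graph *)

Section Graph.
Variables (A : comPzRingType) (R : realFieldType) (ev : {rmorphism A -> R}).
Variables (dt dx dy : derivation A) (z i k : A).
Hypotheses (dxyC : forall f, dx (dy f) = dy (dx f))
  (dtxC : forall f, dt (dx f) = dx (dt f))
  (dtyC : forall f, dt (dy f) = dy (dt f)).

Definition graph_D : A := 1 + dx z ^+ 2 + dy z ^+ 2.
Definition graph_P : A := (1 + dy z ^+ 2) * dx (dx z)
  - 2 * (dx z * dy z) * dx (dy z) + (1 + dx z ^+ 2) * dy (dy z).
Definition graph_Q : A := dx (dx z) * dy (dy z) - dx (dy z) ^+ 2.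

Local Notation D := graph_D.
Local Notation P := graph_P.
Local Notation Q := graph_Q.

Hypotheses (iD : i * D = 1) (kQ : k * Q = 1).
Hypothesis flow : dt z = speed P Q D i.
Let w := pinch P Q D i k.

Hypotheses (p0 : ev (dx z) = 0) (q0 : ev (dy z) = 0) (s0 : ev (dx (dy z)) = 0).
Hypothesis lm_gt0 : 0 < ev (dx (dx z)) * ev (dy (dy z)).
Hypotheses (wx : ev (dx w) = 0) (wy : ev (dy w) = 0)
  (wxx : ev (dx (dx w)) <= 0) (wyy : ev (dy (dy w)) <= 0).

Let s0' : ev (dy (dx z)) = 0. Proof. by rewrite -dxyC. Qed.

(** The first derivatives of [z] and [z_xy] vanish at the point, which leaves few
    terms in the second derivatives of [D], [P] and [Q]. *)
Lemma graph_max_le0 : ev (dt w) <= 0.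
Proof.
have eD : ev D = 1.
  by rewrite /graph_D !ev_jet rmorph1 p0 q0 expr0n /= !addr0.
have eDx : ev (dx D) = 0.
  by rewrite /graph_D !ev_jet !der1 rmorph0 p0 q0; ring.
have eDy : ev (dy D) = 0.
  by rewrite /graph_D !ev_jet !der1 rmorph0 p0 q0; ring.
have eDt : ev (dt D) = 0.
  by rewrite /graph_D !ev_jet !der1 rmorph0 p0 q0; ring.
have eDxx : ev (dx (dx D)) = 2 * ev (dx (dx z)) ^+ 2.
  by rewrite /graph_D !ev_jet !der1 der0 rmorph0 p0 q0 s0; ring.
have eDyy : ev (dy (dy D)) = 2 * ev (dy (dy z)) ^+ 2.
  by rewrite /graph_D !ev_jet !der1 der0 rmorph0 p0 q0 s0'; ring.
have eP : ev P = ev (dx (dx z)) + ev (dy (dy z)).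
  by rewrite /graph_P !ev_jet rmorph1 p0 q0 s0; ring.
have eQ : ev Q = ev (dx (dx z)) * ev (dy (dy z)).
  by rewrite /graph_Q !ev_jet s0; ring.
have ePx : ev (dx P) = ev (dx (dx (dx z))) + ev (dx (dy (dy z))).
  by rewrite /graph_P !ev_jet !der1 !rmorph0 !rmorph1 p0 q0 s0; ring.
have ePy : ev (dy P) = ev (dx (dx (dy z))) + ev (dy (dy (dy z))).
  by rewrite /graph_P !ev_jet !der1 !rmorph0 !rmorph1 p0 q0 s0 -!dxyC; ring.
have eQx : ev (dx Q) = ev (dx (dx (dx z))) * ev (dy (dy z))
    + ev (dx (dx z)) * ev (dx (dy (dy z))).
  by rewrite /graph_Q !ev_jet s0; ring.
have eQy : ev (dy Q) = ev (dx (dx (dy z))) * ev (dy (dy z))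
    + ev (dx (dx z)) * ev (dy (dy (dy z))).
  by rewrite /graph_Q !ev_jet s0 -!dxyC; ring.
have ePxx : ev (dx (dx P)) = ev (dx (dx (dx (dx z)))) + ev (dx (dx (dy (dy z))))
    + 2 * ev (dx (dx z)) ^+ 2 * ev (dy (dy z)).
  by rewrite /graph_P !ev_jet !der1 !der0 !rmorph0 !rmorph1 p0 q0 s0; ring.
have ePyy : ev (dy (dy P)) = ev (dx (dx (dy (dy z)))) + ev (dy (dy (dy (dy z))))
    + 2 * ev (dy (dy z)) ^+ 2 * ev (dx (dx z)).
  rewrite /graph_P !ev_jet !der1 !der0 !rmorph0 !rmorph1 p0 q0 s0 s0' -!dxyC.
  by ring.
have eQxx : ev (dx (dx Q)) = ev (dx (dx (dx (dx z)))) * ev (dy (dy z))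
    + ev (dx (dx z)) * ev (dx (dx (dy (dy z))))
    + 2 * ev (dx (dx (dx z))) * ev (dx (dy (dy z))) - 2 * ev (dx (dx (dy z))) ^+ 2.
  by rewrite /graph_Q !ev_jet s0; ring.
have eQyy : ev (dy (dy Q)) = ev (dx (dx (dy (dy z)))) * ev (dy (dy z))
    + ev (dx (dx z)) * ev (dy (dy (dy (dy z))))
    + 2 * ev (dx (dx (dy z))) * ev (dy (dy (dy z))) - 2 * ev (dx (dy (dy z))) ^+ 2.
  by rewrite /graph_Q !ev_jet s0 -!dxyC; ring.
have ePt : ev (dt P) = ev (dx (dx (speed P Q D i))) + ev (dy (dy (speed P Q D i))).
  rewrite -flow /graph_P !ev_jet !der1 !rmorph0 !rmorph1 p0 q0 s0.
  by rewrite !dtxC !dtyC; ring.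
have eQt : ev (dt Q) = ev (dy (dy z)) * ev (dx (dx (speed P Q D i)))
    + ev (dx (dx z)) * ev (dy (dy (speed P Q D i))).
  by rewrite -flow /graph_Q !ev_jet s0 !dtxC !dtyC; ring.
rewrite /w (ev_d_pinch _ iD kQ eD eDt) ePt eQt.
rewrite (ev_dd_speed _ _ iD eD eDx) (ev_dd_speed _ _ iD eD eDy).
move: wx wy wxx wyy.
rewrite /w (ev_d_pinch _ iD kQ eD eDx) (ev_d_pinch _ iD kQ eD eDy).
rewrite (ev_dd_pinch _ iD kQ eD eDx) (ev_dd_pinch _ iD kQ eD eDy).
rewrite eP eQ ePx ePy eQx eQy ePxx ePyy eQxx eQyy eDxx eDyy => wx' wy' wxx' wyy'.
exact: (pinch_evolution_le0 lm_gt0 wx' wy' wxx' wyy').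
Qed.

End Graph.

(** * Graph coordinates inside a chart *)

Section Forms.
Variable A : comPzRingType.
Implicit Types u v a b c : A * A * A.

Definition dot3 u v : A := u.1.1 * v.1.1 + u.1.2 * v.1.2 + u.2 * v.2.
Definition cross3 u v : A * A * A :=
  (u.1.2 * v.2 - u.2 * v.1.2, u.2 * v.1.1 - u.1.1 * v.2,
   u.1.1 * v.1.2 - u.1.2 * v.1.1).

(** The forms of a parametrized surface with first derivatives [u], [v] and second
    derivatives [a], [b], [c]: the determinant of the metric and, relative to the
    unnormalised normal [cross3 u v], the trace of the second fundamental form
    multiplied by the determinant of the metric, and its determinant. *)
Definition gram u v : A := dot3 u u * dot3 v v - dot3 u v ^+ 2.
Definition trII u v a b c : A :=
  dot3 v v * dot3 (cross3 u v) a - 2 * dot3 u v * dot3 (cross3 u v) b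
  + dot3 u u * dot3 (cross3 u v) c.
Definition detII u v a b c : A :=
  dot3 (cross3 u v) a * dot3 (cross3 u v) c - dot3 (cross3 u v) b ^+ 2.
End Forms.

Section GraphCoordinates.
Variables (A : comPzRingType) (d0 d1 d2 : derivation A) (x y j : A).
Hypotheses (d01 : forall f, d0 (d1 f) = d1 (d0 f))
  (d02 : forall f, d0 (d2 f) = d2 (d0 f))
  (d12 : forall f, d1 (d2 f) = d2 (d1 f)).
Hypothesis jJ : j * (d1 x * d2 y - d2 x * d1 y) = 1.

(** The coordinate vector fields of the coordinates [t, x, y], where [j] is the
    inverse of the Jacobian of [x, y] in the parameters of the chart. The time
    derivative [dT] at fixed [x, y] corrects [d0] for the tangential motion. *)
Definition dX : derivation A := der_comb d1 d2 (j * d2 y) (- (j * d1 y)).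
Definition dY : derivation A := der_comb d1 d2 (- (j * d2 x)) (j * d1 x).
Definition dT : derivation A :=
  der_comb (der_comb d0 dX 1 (- d0 x)) dY 1 (- d0 y).

Lemma dXE f : dX f = j * d2 y * d1 f - j * d1 y * d2 f.
Proof. by rewrite /= mulNr. Qed.

Lemma dYE f : dY f = - (j * d2 x * d1 f) + j * d1 x * d2 f.
Proof. by rewrite /= mulNr. Qed.

Lemma dTE f : dT f = d0 f - d0 x * dX f - d0 y * dY f.
Proof. by rewrite /=; ring. Qed.

(* The hypothesis in the form of a rewrite rule for a monomial. *)
Let jJ' : j * d1 x * d2 y = 1 + j * d2 x * d1 y.
Proof. by rewrite -jJ; ring. Qed.

Lemma d1E f : d1 f = d1 x * dX f + d1 y * dY f.
Proof. by rewrite dXE dYE; ring: jJ'. Qed.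

Lemma d2E f : d2 f = d2 x * dX f + d2 y * dY f.
Proof. by rewrite dXE dYE; ring: jJ'. Qed.

(** Coordinate vector fields commute; with [j] differentiated as an inverse this
    is a polynomial identity. *)
Lemma dXYC f : dX (dY f) = dY (dX f).
Proof.
rewrite !(dXE, dYE) !derE !(der_inv _ jJ) !derE -!d12.
by ring: jJ'.
Qed.

Lemma dTXC f : dT (dX f) = dX (dT f).
Proof.
rewrite !dTE !(dXE, dYE) !derE !(der_inv _ jJ) !derE !d01 !d02 -!d12.
by ring: jJ'.
Qed.

Lemma dTYC f : dT (dY f) = dY (dT f).
Proof.
rewrite !dTE !(dXE, dYE) !derE !(der_inv _ jJ) !derE !d01 !d02 -!d12.
by ring: jJ'.
Qed.
End GraphCoordinates.

Section ChartMaximum.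
Variables (A : comPzRingType) (R : realFieldType) (ev : {rmorphism A -> R}).
Variables (d0 d1 d2 : derivation A) (x y z i j k : A).
Hypotheses (d01 : forall f, d0 (d1 f) = d1 (d0 f))
  (d02 : forall f, d0 (d2 f) = d2 (d0 f))
  (d12 : forall f, d1 (d2 f) = d2 (d1 f)).

Let X1 := (d1 x, d1 y, d1 z).
Let X2 := (d2 x, d2 y, d2 z).
Let X11 := (d1 (d1 x), d1 (d1 y), d1 (d1 z)).
Let X12 := (d1 (d2 x), d1 (d2 y), d1 (d2 z)).
Let X22 := (d2 (d2 x), d2 (d2 y), d2 (d2 z)).
Let J := d1 x * d2 y - d2 x * d1 y.
Let D := gram X1 X2.
Let P := trII X1 X2 X11 X12 X22.
Let Q := detII X1 X2 X11 X12 X22.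

Hypotheses (jJ : j * J = 1) (iD : i * D = 1) (kQ : k * Q = 1).

Local Notation dX := (dX d1 d2 y j).
Local Notation dY := (dY d1 d2 x j).
Local Notation dT := (dT d0 d1 d2 x y j).
Local Notation Dg := (graph_D dX dY z).
Local Notation Pg := (graph_P dX dY z).
Local Notation Qg := (graph_Q dX dY z).

Let z1E : d1 z = d1 x * dX z + d1 y * dY z. Proof. exact: d1E. Qed.
Let z2E : d2 z = d2 x * dX z + d2 y * dY z. Proof. exact: d2E. Qed.

Let d1p : d1 (dX z) = d1 x * dX (dX z) + d1 y * dX (dY z).
Proof. by rewrite (d1E jJ (dX z)) -(dXYC d12 jJ). Qed.
Let d1q : d1 (dY z) = d1 x * dX (dY z) + d1 y * dY (dY z).
Proof. by rewrite (d1E jJ (dY z)). Qed.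
Let d2p : d2 (dX z) = d2 x * dX (dX z) + d2 y * dX (dY z).
Proof. by rewrite (d2E jJ (dX z)) -(dXYC d12 jJ). Qed.
Let d2q : d2 (dY z) = d2 x * dX (dY z) + d2 y * dY (dY z).
Proof. by rewrite (d2E jJ (dY z)). Qed.

Let z11E : d1 (d1 z) = d1 (d1 x) * dX z + d1 (d1 y) * dY z +
  d1 x ^+ 2 * dX (dX z) + 2 * d1 x * d1 y * dX (dY z) + d1 y ^+ 2 * dY (dY z).
Proof. by rewrite z1E derD (derM _ (d1 x)) (derM _ (d1 y)) d1p d1q; ring. Qed.

Let z12E : d1 (d2 z) = d1 (d2 x) * dX z + d1 (d2 y) * dY z +
  d1 x * d2 x * dX (dX z) + (d1 x * d2 y + d2 x * d1 y) * dX (dY z)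
  + d1 y * d2 y * dY (dY z).
Proof. by rewrite z2E derD (derM _ (d2 x)) (derM _ (d2 y)) d1p d1q; ring. Qed.

Let z22E : d2 (d2 z) = d2 (d2 x) * dX z + d2 (d2 y) * dY z +
  d2 x ^+ 2 * dX (dX z) + 2 * d2 x * d2 y * dX (dY z) + d2 y ^+ 2 * dY (dY z).
Proof. by rewrite z2E derD (derM _ (d2 x)) (derM _ (d2 y)) d2p d2q; ring. Qed.

(** Change of parameters: the second derivatives of [x] and [y] are multiplied by
    tangent vectors, hence disappear in the products with the normal. *)
Lemma gramE : D = J ^+ 2 * Dg.
Proof. by rewrite /D /gram /dot3 /= z1E z2E /graph_D /J; ring. Qed.

Lemma trIIE : P = J ^+ 3 * Pg.
Proof.
rewrite /P /trII /dot3 /cross3 /= z11E z12E z22E z1E z2E /graph_P /J.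
move: (dX (dX z)) (dX (dY z)) (dY (dY z)) (dX z) (dY z) => r s t p q.
by ring.
Qed.

Lemma detIIE : Q = J ^+ 4 * Qg.
Proof.
rewrite /Q /detII /dot3 /cross3 /= z11E z12E z22E z1E z2E /graph_Q /J.
move: (dX (dX z)) (dX (dY z)) (dY (dY z)) (dX z) (dY z) => r s t p q.
by ring.
Qed.

Let n := cross3 X1 X2.
Let phi := (P ^+ 3 - 3 * P * Q * D) * i ^+ 5.
Hypothesis flow : (d0 x, d0 y, d0 z) = (phi * n.1.1, phi * n.1.2, phi * n.2).
Let w := pinch P Q D i k.

Let ig := i * J ^+ 2.
Let kg := k * J ^+ 4.
Let igD : ig * Dg = 1. Proof. by rewrite -iD gramE /ig; ring. Qed.
Let kgQ : kg * Qg = 1. Proof. by rewrite -kQ detIIE /kg; ring. Qed.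

Lemma pinch_graph : w = pinch Pg Qg Dg ig kg.
Proof. by rewrite /w /pinch gramE trIIE detIIE /ig /kg; ring. Qed.

(** The tangential part of the motion only changes the parametrization, so that
    the height over a fixed point moves with the normal velocity divided by the
    vertical component of the unit normal. *)
Lemma flow_graph : dT z = speed Pg Qg Dg ig.
Proof.
have [fx fy fz] := flow.
have -> : dT z = phi * J * Dg.
  rewrite dTE fx fy fz /graph_D /J; move: phi (dX z) (dY z) z1E z2E => f p q.
  by rewrite /n /= => -> ->; ring.
have -> : phi * J = (Pg ^+ 3 - 3 * Pg * Qg * Dg) * ig ^+ 5.
  rewrite /phi gramE trIIE detIIE /ig; move: Pg Qg Dg J i; clear.
  move=> P Q D J i; ring.
by rewrite /speed; ring: igD.
Qed.

Hypotheses (z1_0 : ev (d1 z) = 0) (z2_0 : ev (d2 z) = 0).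
(* At the point, z_xy = 0 in terms of the derivatives in the chart. *)
Hypothesis principal :
  ev (- (d2 x * d2 y) * d1 (d1 z) + (d1 x * d2 y + d2 x * d1 y) * d1 (d2 z)
      - d1 x * d1 y * d2 (d2 z)) = 0.
Hypothesis Q_gt0 : 0 < ev Q.
Hypotheses (w1 : ev (d1 w) = 0) (w2 : ev (d2 w) = 0).
Hypothesis hess_le0 : forall a b : R, a ^+ 2 * ev (d1 (d1 w))
  + 2 * a * b * ev (d1 (d2 w)) + b ^+ 2 * ev (d2 (d2 w)) <= 0.

(** At a critical point of [w], moving tangentially does not change [w] to first
    order, and the second derivatives of [w] in the directions [x] and [y] are
    those along the corresponding directions of the chart. *)
Lemma chart_max_le0 : ev (d0 w) <= 0.
Proof.
have X0 f : ev (d1 f) = 0 -> ev (d2 f) = 0 -> ev (dX f) = 0.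
  by move=> h1 h2; rewrite dXE rmorphB !rmorphM h1 h2 !mulr0 subr0.
have Y0 f : ev (d1 f) = 0 -> ev (d2 f) = 0 -> ev (dY f) = 0.
  by move=> h1 h2; rewrite dYE rmorphD rmorphN !rmorphM h1 h2 !mulr0 oppr0 addr0.
have XX f : ev (d1 f) = 0 -> ev (d2 f) = 0 -> ev (dX (dX f)) =
    ev (j * d2 y) ^+ 2 * ev (d1 (d1 f))
    + 2 * ev (j * d2 y) * ev (- (j * d1 y)) * ev (d1 (d2 f))
    + ev (- (j * d1 y)) ^+ 2 * ev (d2 (d2 f)).
  by move=> h1 h2; rewrite !dXE !derE -!d12 !ev_jet h1 h2; ring.
have YY f : ev (d1 f) = 0 -> ev (d2 f) = 0 -> ev (dY (dY f)) =
    ev (- (j * d2 x)) ^+ 2 * ev (d1 (d1 f))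
    + 2 * ev (- (j * d2 x)) * ev (j * d1 x) * ev (d1 (d2 f))
    + ev (j * d1 x) ^+ 2 * ev (d2 (d2 f)).
  by move=> h1 h2; rewrite !dYE !derE -!d12 !ev_jet h1 h2; ring.
have -> : ev (d0 w) = ev (dT w).
  by rewrite dTE !rmorphB [in RHS]rmorphM (X0 w) // [in RHS]rmorphM (Y0 w) // !mulr0 !subr0.
have s0 : ev (dX (dY z)) = 0.
  have h : ev (dX (dY z)) = ev (j ^+ 2) * 
  ev (- (d2 x * d2 y) * d1 (d1 z) + (d1 x * d2 y + d2 x * d1 y) * d1 (d2 z)
      - d1 x * d1 y * d2 (d2 z)).
    rewrite dXE !dYE !derE -!d12 !ev_jet z1_0 z2_0; ring.
  by rewrite h principal mulr0.
rewrite pinch_graph.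
apply: (graph_max_le0 (dXYC d12 jJ) (dTXC d01 d02 d12 jJ)
  (dTYC d01 d02 d12 jJ) igD kgQ flow_graph).
- exact: X0.
- exact: Y0.
- exact: s0.
- have [J0 _] := ev_inv ev jJ.
  have eQg : ev Qg = ev (dX (dX z)) * ev (dY (dY z)).
    by rewrite /graph_Q rmorphB rmorphM [X in _ - X]rmorphXn s0 expr0n subr0.
  have := Q_gt0; rewrite detIIE rmorphM rmorphXn eQg.
  by rewrite pmulr_rgt0 // exprn_even_gt0.
- by rewrite -pinch_graph; apply: X0.
- by rewrite -pinch_graph; apply: Y0.
- by rewrite -pinch_graph XX; first exact: hess_le0.
- by rewrite -pinch_graph YY; first exact: hess_le0.
Qed.
End ChartMaximum.

(** * Closure of smooth functions under the ring operations *)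

Section SmoothClosure.
Variables (R : realType) (V : normedModType R).
Implicit Types (O : set V) (k : nat).

Lemma Ck_cont (W : normedModType R) k O (f : V -> W) x :
  Ck_on k O f -> O x -> {for x, continuous f}.
Proof. by case: k => [|k] [h _] /h. Qed.

Lemma Ck_sub (W : normedModType R) k O O' (f : V -> W) :
  O' `<=` O -> Ck_on k O f -> Ck_on k O' f.
Proof.
move=> sO; elim: k f => [|k IHk] f [cf df].
  by split=> // x /sO /cf.
split=> [x /sO /cf //|v].
by have [dv ck] := df v; split=> [x /sO /dv //|]; exact: IHk.
Qed.

Lemma Ck_ext (W : normedModType R) k O (f g : V -> W) : open O ->
  (forall x, O x -> f x = g x) -> Ck_on k O f -> Ck_on k O g.
Proof.
move=> oO; have near_fg (f' g' : V -> W) x : (forall x, O x -> f' x = g' x) ->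
    O x -> \forall y \near x, f' y = g' y.
  by move=> fg Ox; near do apply: fg; exact: open_nbhs_nbhs.
have cont (f' g' : V -> W) x : (forall x, O x -> f' x = g' x) -> O x ->
    {for x, continuous f'} -> {for x, continuous g'}.
  move=> fg Ox; rewrite /prop_for /continuous_at -fg //.
  by apply: cvg_trans; apply: near_eq_cvg; exact: near_fg.
elim: k f g => [|k IHk] f g fg [cf df].
  by split=> // x Ox; apply: (cont _ _ _ fg Ox); exact: cf.
split=> [x Ox|v]; first by apply: (cont _ _ _ fg Ox); exact: cf.
have [dv ck] := df v; split=> [x Ox|].
  by apply: near_eq_derivable (dv x Ox); exact: near_fg.
by apply: IHk ck => x Ox; apply: near_eq_derive; exact: near_fg.
Unshelve. all: by end_near. Qed.

Lemma Ck_le (W : normedModType R) k O (f : V -> W) :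
  Ck_on k.+1 O f -> Ck_on k O f.
Proof.
elim: k f => [|k IHk] f [cf df]; first by [].
split=> // v.
by have [dv ck] := df v; split=> //; exact: IHk.
Qed.

Lemma Ck_cst (W : normedModType R) k O (c : W) : open O -> Ck_on k O (cst c).
Proof.
move=> oO; elim: k c => [|k IHk] c; first by split=> // x _; exact: cvg_cst.
split=> [x _|v]; first exact: cvg_cst.
split=> [x _|]; first exact: derivable_cst.
by apply: (Ck_ext oO _ (IHk 0)) => x _; rewrite derive_cst.
Qed.

Lemma Ck_add k O (f g : V -> R) : open O ->
  Ck_on k O f -> Ck_on k O g -> Ck_on k O (f + g).
Proof.
move=> oO; elim: k f g => [|k IHk] f g [cf df] [cg dg].
  by split=> // x Ox; apply: cvgD; [exact: cf|exact: cg].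
split=> [x Ox|v]; first by apply: cvgD; [exact: cf|exact: cg].
have [df' ckf] := df v; have [dg' ckg] := dg v.
split=> [x Ox|]; first by apply: derivableD; [exact: df'|exact: dg'].
apply: (Ck_ext oO _ (IHk _ _ ckf ckg)) => x Ox.
by rewrite deriveD; [|exact: df'|exact: dg'].
Qed.

Lemma Ck_mul k O (f g : V -> R) : open O ->
  Ck_on k O f -> Ck_on k O g -> Ck_on k O (f * g).
Proof.
move=> oO; elim: k f g => [|k IHk] f g ckf ckg.
  split=> // x Ox; apply: cvgM; [exact: Ck_cont ckf Ox|exact: Ck_cont ckg Ox].
split=> [x Ox|v].
  by apply: cvgM; [exact: Ck_cont ckf Ox|exact: Ck_cont ckg Ox].
have [df' ckdf] := ckf.2 v; have [dg' ckdg] := ckg.2 v.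
split=> [x Ox|]; first by apply: derivableM; [exact: df'|exact: dg'].
apply: (@Ck_ext _ k _ (f * 'D_v g + g * 'D_v f)) => // [x Ox|].
  by rewrite deriveM; [|exact: df'|exact: dg'].
by apply: Ck_add => //; apply: IHk => //; exact: Ck_le.
Qed.

Lemma Ck_opp k O (f : V -> R) : open O -> Ck_on k O f -> Ck_on k O (- f).
Proof.
move=> oO ckf; apply: (@Ck_ext _ k _ (cst (- 1) * f)) => // [x Ox|].
  exact: mulN1r.
by apply: Ck_mul => //; exact: Ck_cst.
Qed.

Lemma Ck_inv k O (f : V -> R) : open O -> (forall x, O x -> f x != 0) ->
  Ck_on k O f -> Ck_on k O (fun x => (f x)^-1).
Proof.
move=> oO f0; elim: k f f0 => [|k IHk] f f0 ckf.
  by split=> // x Ox; apply: cvgV; [exact: f0|exact: Ck_cont ckf Ox].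
split=> [x Ox|v]; first by apply: cvgV; [exact: f0|exact: Ck_cont ckf Ox].
have [df' ckdf] := ckf.2 v.
split=> [x Ox|]; first by apply: derivableV; [exact: f0|exact: df'].
have cki := IHk f f0 (Ck_le ckf).
set g := fun x => (f x)^-1 in cki *.
apply: (@Ck_ext _ k _ (- (g * g * 'D_v f))) => // [x Ox|].
  rewrite deriveV; [|exact: f0|exact: df'].
  by rewrite scaleNr expr2 invfM.
by apply: Ck_opp => //; apply: Ck_mul => //; apply: Ck_mul.
Qed.

Lemma Ck_derive (W : normedModType R) k O (f : V -> W) v :
  Ck_on k.+1 O f -> Ck_on k O ('D_v f).
Proof. by case=> _ /(_ v) []. Qed.

Lemma Ck_derivable (W : normedModType R) k O (f : V -> W) v x :
  Ck_on k.+1 O f -> O x -> derivable f x v.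
Proof. by case=> _ /(_ v) [h _] /h. Qed.

Lemma derive_coord n (f : V -> 'rV[R]_n) x v i : derivable f x v ->
  'D_v (fun y => f y 0 i) x = ('D_v f x) 0 i.
Proof. by move=> df; rewrite (derive_mx df) mxE. Qed.

Lemma Ck_coord n k O (f : V -> 'rV[R]_n) i : open O ->
  Ck_on k O f -> Ck_on k O (fun x => f x 0 i).
Proof.
move=> oO; have cont (f' : V -> 'rV[R]_n) x : {for x, continuous f'} ->
    {for x, continuous (fun x => f' x 0 i)}.
  move=> cf; apply: (@continuous_comp _ _ _ f' (fun M : 'rV[R]_n => M 0 i)) => //.
  exact: coord_continuous.
elim: k f => [|k IHk] f ckf.
  by split=> // x Ox; apply: cont; exact: Ck_cont ckf Ox.
split=> [x Ox|v]; first by apply: cont; exact: Ck_cont ckf Ox.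
split=> [x Ox|].
  exact: (derivable_mxP _ _ _).1 (Ck_derivable ckf Ox) 0 i.
apply: (Ck_ext oO _ (IHk _ (Ck_derive v ckf))) => x Ox.
by rewrite derive_coord //; exact: Ck_derivable ckf Ox.
Qed.

End SmoothClosure.

(** * Calculus along lines *)

Section Lines.
Variables (R : realType) (V : normedModType R).
Implicit Types (f : V -> R) (a v w : V) (h : R).

Lemma is_derive_line f a v h : derivable f (a + h *: v) v ->
  is_derive h (1 : R) (fun s : R => f (a + s *: v)) ('D_v f (a + h *: v)).
Proof.
have e : (fun s : R => s^-1 *: (((fun s : R => f (a + s *: v)) \o shift h) (s *: (1 : R))
     - f (a + h *: v))) =
    (fun s : R => s^-1 *: ((f \o shift (a + h *: v)) (s *: v) - f (a + h *: v))).
  apply/funext => s /=; congr (_ *: (f _ - _)).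
  by rewrite [s *: (1 : R)]mulr1 scalerDl addrCA.
by move=> df; apply: DeriveDef; rewrite /derivable /derive e.
Qed.

Lemma derive_line f a v : derivable f a v ->
  is_derive (0 : R) (1 : R) (fun s : R => f (a + s *: v)) ('D_v f a).
Proof.
by have := @is_derive_line f a v 0; rewrite scale0r addr0; exact.
Qed.

Lemma MVT_line f a v h : 0 < h ->
  (forall s, 0 <= s <= h -> derivable f (a + s *: v) v) ->
  exists2 c, 0 < c < h & f (a + h *: v) - f a = h * 'D_v f (a + c *: v).
Proof.
move=> h0 df.
have [||c ch] := @MVT R (fun s : R => f (a + s *: v)) (fun s => 'D_v f (a + s *: v)) 0 h h0.
- move=> s /[!in_itv]/= /andP[s0 sh]; apply: is_derive_line; apply: df.
  by rewrite !ltW.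
- apply: derivable_within_continuous => s /[!in_itv]/= sh.
  by case: (is_derive_line (df s sh)).
rewrite scale0r addr0 subr0 mulrC => e; exists c => //.
Qed.

Lemma derive_scale f a v h : derivable f a v -> derivable f a (h *: v) ->
  'D_(h *: v) f a = h * 'D_v f a.
Proof.
move=> dv dhv; have [dg <-] := derive_line dv; have [_ <-] := derive_line dhv.
set g := (fun s : R => f (a + s *: v)) in dg *.
pose m : R -> R := id * cst h.
have -> : (fun s : R => f (a + s *: (h *: v))) = g \o m.
  by apply/funext => s /=; rewrite /g scalerA.
have d1 : derivable (@id R) (0 : R) (1 : R) by exact: derivable_id.
have d2 : derivable (cst h : R -> R) (0 : R) (1 : R) by exact: derivable_cst.
have dm : derivable m 0 1 := derivableM d1 d2.
have m0 : m 0 = 0 by exact: mul0r.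
have dg' : derivable g (m 0) 1 := eq_ind_r (fun x => derivable g x 1) dg m0.
have := derive1_comp dm dg'; rewrite m0 !derive1E => ->.
rewrite (deriveM d1 d2) derive_id derive_cst scaler0 add0r mulrC.
by congr (_ * _); exact: mulr1.
Qed.

Lemma nbhs_plane a v w (U : set V) : nbhs a U ->
  exists2 d : R, 0 < d & forall s t, `|s| < d -> `|t| < d -> U (a + s *: v + t *: w).
Proof.
move=> aU.
have : \forall z \near ((0 : R), (0 : R)), U (a + z.1 *: v + z.2 *: w).
  have : (fun z : R * R => a + z.1 *: v + z.2 *: w) @ ((0 : R), (0 : R)) --> a.
    rewrite -[X in _ --> X]addr0 -[X in _ --> X + _]addr0.
    apply: cvgD; first apply: cvgD.
    - exact: cvg_cst.
    - rewrite -(scale0r v); apply: cvgZr_tmp; exact: cvg_fst.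
    - rewrite -(scale0r w); apply: cvgZr_tmp; exact: cvg_snd.
  by apply.
case=> -[P Q] /= [[d1 /= d10 P1] [d2 /= d20 Q2]] PQ.
exists (Num.min d1 d2); first by rewrite lt_min d10.
move=> s t; rewrite !lt_min => /andP[s1 _] /andP[_ t2].
by apply: (PQ (s, t)); split; [apply: P1|apply: Q2]; rewrite /= sub0r normrN.
Qed.

(** Turns the mean value theorem into an identity between derivatives at one
    point: it suffices to have the identity at points arbitrarily close to it. *)
Lemma continuous_eq_add (F G H : V -> R) a :
  {for a, continuous F} -> {for a, continuous G} -> {for a, continuous H} ->
  (forall U, nbhs a U -> exists x y z, [/\ U x, U y, U z & F x = G y + H z]) ->
  F a = G a + H a.
Proof.
move=> /cvgrPdist_lt cF /cvgrPdist_lt cG /cvgrPdist_lt cH ex.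
apply/eqP/negPn/negP => ne.
have e0 : 0 < `|F a - (G a + H a)| / 3 by rewrite divr_gt0 // normr_gt0 subr_eq0.
have [x [y [z [[[hx _] _] [[_ hy] _] [_ hz] e]]]] :=
  ex _ (filterI (filterI (cF _ e0) (cG _ e0)) (cH _ e0)).
move: hx hy hz e e0; set X := F a; set Y := G a; set Z := H a.
move: (F x) (G y) (H z) => x' y' z' /= hx hy hz e.
have : `|X - (Y + Z)| <= `|X - x'| + (`|Y - y'| + `|Z - z'|).
  rewrite (_ : X - (Y + Z) = X - x' - ((Y - y') + (Z - z'))); last by rewrite e; ring.
  by rewrite (le_trans (ler_normB _ _)) // lerD2l ler_normD.
by move: hx hy hz; lra.
Qed.

End Lines.

Section C2.
Variables (R : realType) (V : normedModType R) (O : set V).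
Hypothesis oO : open O.
Implicit Types (f : V -> R) (a v w : V).

Let nO a : O a -> nbhs a O. Proof. by move=> ?; exact: open_nbhs_nbhs. Qed.

(** The mean value theorem along the sides [v], [w] and [v + w] of a small
    triangle. *)
Lemma derive_dirD f a v w : Ck_on 1 O f -> O a ->
  'D_(v + w) f a = 'D_v f a + 'D_w f a.
Proof.
move=> cf Oa; have cD u : {for a, continuous ('D_u f)}.
  exact: Ck_cont (Ck_derive u cf) Oa.
apply: (@continuous_eq_add _ _ ('D_(v + w) f) ('D_v f) ('D_w f)) => // U aU.
have [d d0 UO] := @nbhs_plane _ _ a v w _ (filterI aU (nO Oa)).
have h0 : 0 < d / 2 by rewrite divr_gt0.
have hd s : 0 <= s <= d / 2 -> `|s| < d.
  by move=> /andP[s0 sd]; rewrite ger0_norm //; lra.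
have hd' s : 0 < s < d / 2 -> `|s| < d.
  by move=> /andP[s0 sd]; apply: hd; rewrite !ltW.
have dd : `|d / 2| < d by rewrite ger0_norm; lra.
have z : `|0 : R| < d by rewrite normr0.
have [|c1 hc1 e1] := @MVT_line _ _ f a (v + w) _ h0.
  move=> s hs; apply: (Ck_derivable cf).
  by rewrite scalerDr addrA; apply: (UO s s (hd _ hs) (hd _ hs)).2.
have [|c2 hc2 e2] := @MVT_line _ _ f a v _ h0.
  move=> s hs; apply: (Ck_derivable cf).
  by have := (UO s 0 (hd _ hs) z).2; rewrite scale0r addr0.
have [|c3 hc3 e3] := @MVT_line _ _ f (a + (d / 2) *: v) w _ h0.
  by move=> s hs; apply: (Ck_derivable cf); exact: (UO _ s dd (hd _ hs)).2.
exists (a + c1 *: (v + w)), (a + c2 *: v), (a + (d / 2) *: v + c3 *: w); split.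
- by rewrite scalerDr addrA; apply: (UO _ _ (hd' _ hc1) (hd' _ hc1)).1.
- by have := (UO c2 0 (hd' _ hc2) z).1; rewrite scale0r addr0.
- exact: (UO _ _ dd (hd' _ hc3)).1.
apply: (mulfI (lt0r_neq0 h0)); rewrite mulrDr -e1 -e2 -e3.
by rewrite scalerDr addrA; ring.
Qed.

Lemma second_difference f a v w h : Ck_on 2 O f -> 0 < h ->
  (forall s t, 0 <= s <= h -> 0 <= t <= h -> O (a + s *: v + t *: w)) ->
  exists c1 c2, [/\ 0 < c1 < h, 0 < c2 < h &
    f (a + h *: v + h *: w) - f (a + h *: v) - f (a + h *: w) + f a =
    h * (h * 'D_w ('D_v f) (a + c1 *: v + c2 *: w))].
Proof.
move=> cf h0 hO.
have hh : 0 <= h <= h by rewrite ltW /=.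
have zz : 0 <= (0 : R) <= h by rewrite lexx ltW.
have d1 s : 0 <= s <= h -> is_derive s (1 : R)
    ((fun s : R => f (a + h *: w + s *: v)) - (fun s => f (a + s *: v)))
    ('D_v f (a + h *: w + s *: v) - 'D_v f (a + s *: v)).
  move=> hs; apply: is_deriveB; apply: is_derive_line; apply: (Ck_derivable (Ck_le cf)).
    by rewrite addrAC; exact: hO.
  by have := hO s 0 hs zz; rewrite scale0r addr0.
have [||c1 hc1] := @MVT R
    ((fun s : R => f (a + h *: w + s *: v)) - (fun s => f (a + s *: v)))
    (fun s => 'D_v f (a + h *: w + s *: v) - 'D_v f (a + s *: v)) _ _ h0.
- by move=> s; rewrite in_itv /= => /andP[s0 sh]; apply: d1; rewrite !ltW.
- apply: derivable_within_continuous => s /[!in_itv]/= sh.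
  by case: (d1 s sh).
rewrite -![(_ - _ : _ -> _) _]/(_ - _) /= subr0 !scale0r !addr0 => e1.
have {}hc1 : 0 < c1 < h by move: hc1; rewrite in_itv.
have hc1' : 0 <= c1 <= h by case/andP: hc1 => c0 ch; rewrite !ltW.
have [|c2 hc2 e2] := @MVT_line _ _ ('D_v f) (a + c1 *: v) w _ h0.
  by move=> s hs; apply: (Ck_derivable (Ck_derive v cf)); exact: hO.
exists c1, c2; split=> //; rewrite -e2 mulrC.
rewrite [a + c1 *: v + _]addrAC -e1 [a + h *: w + _]addrAC.
by rewrite opprB addrA addrAC.
Qed.

(** The second difference over a small parallelogram is symmetric in [v] and [w]
    and yields mixed derivatives in either order. *)
Lemma deriveC f a v w : Ck_on 2 O f -> O a ->
  'D_v ('D_w f) a = 'D_w ('D_v f) a.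
Proof.
move=> cf Oa.
have cD u u' : {for a, continuous ('D_u ('D_u' f))}.
  exact: Ck_cont (Ck_derive u (Ck_derive u' cf)) Oa.
rewrite -[RHS]addr0.
apply: (@continuous_eq_add _ _ ('D_v ('D_w f)) ('D_w ('D_v f)) (cst 0)) => //; first exact: cvg_cst.
move=> U aU.
have [d d0 UO] := @nbhs_plane _ _ a v w _ (filterI aU (nO Oa)).
have h0 : 0 < d / 2 by rewrite divr_gt0.
have hd s : 0 <= s <= d / 2 -> `|s| < d.
  by move=> /andP[s0 sd]; rewrite ger0_norm //; lra.
have hd' s : 0 < s < d / 2 -> `|s| < d.
  by move=> /andP[s0 sd]; apply: hd; rewrite !ltW.
have [|c1 [c2 [hc1 hc2 e1]]] := @second_difference f a v w _ cf h0.
  by move=> s t hs ht; exact: (UO s t (hd _ hs) (hd _ ht)).2.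
have [|c3 [c4 [hc3 hc4 e2]]] := @second_difference f a w v _ cf h0.
  by move=> s t hs ht; rewrite addrAC; exact: (UO t s (hd _ ht) (hd _ hs)).2.
exists (a + c3 *: w + c4 *: v), (a + c1 *: v + c2 *: w), a; split.
- by rewrite addrAC; exact: (UO _ _ (hd' _ hc4) (hd' _ hc3)).1.
- exact: (UO _ _ (hd' _ hc1) (hd' _ hc2)).1.
- exact: nbhs_singleton.
rewrite addr0; apply: (mulfI (lt0r_neq0 h0)); apply: (mulfI (lt0r_neq0 h0)).
apply: etrans (esym e2) _; apply: etrans _ e1.
rewrite (addrAC a ((d / 2) *: w)); congr (_ + _); exact: addrAC.
Qed.

Lemma derive_max_eq0 f a v : Ck_on 1 O f -> O a ->
  (\forall s \near (0 : R), f (a + s *: v) <= f a) -> 'D_v f a = 0.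
Proof.
move=> cf Oa [e /= e0 fmax].
have [d d0 UO] := @nbhs_plane _ _ a v 0 _ (nO Oa).
pose r := Num.min d e; have r0 : 0 < r by rewrite lt_min d0.
have rP s : s \in `]- r, r[%R -> `|s| < d /\ `|s| < e.
  by rewrite in_itv /= -ltr_norml lt_min => /andP[].
have df s : s \in `]- r, r[%R ->
    is_derive s (1 : R) (fun s : R => f (a + s *: v)) ('D_v f (a + s *: v)).
  move=> /rP[sd _]; apply: is_derive_line; apply: (Ck_derivable cf).
  by have := UO s s sd sd; rewrite scaler0 addr0.
have z0 : 0 \in `]- r, r[%R by rewrite in_itv /= oppr_lt0 r0.
have [|||_ <-] := @derive1_at_max R (fun s : R => f (a + s *: v)) (- r) r 0 _ _ z0.
- by rewrite ge0_cp // ltW.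
- by move=> s /df [].
- move=> s /rP[_ se]; rewrite scale0r addr0; apply: fmax.
  by rewrite /= sub0r normrN.
by have [_ ->] := df 0 z0; rewrite scale0r addr0.
Qed.

(** Otherwise the derivative along the line, which vanishes at [a], would be
    positive just after [a], and [f] would increase. *)
Lemma derive2_max_le0 f a v : Ck_on 2 O f -> O a ->
  (\forall s \near (0 : R), f (a + s *: v) <= f a) -> 'D_v ('D_v f) a <= 0.
Proof.
move=> cf Oa fmax; have df0 := derive_max_eq0 (Ck_le cf) Oa fmax.
rewrite leNgt; apply/negP => d2.
have c2 : {for a, continuous ('D_v ('D_v f))}.
  exact: Ck_cont (Ck_derive v (Ck_derive v cf)) Oa.
have [d d0 UO] := @nbhs_plane _ _ a v 0 _ (filterI (nO Oa) (cvgr_gt _ c2 _ d2)).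
have {}UO s : `|s| < d -> O (a + s *: v) /\ 0 < 'D_v ('D_v f) (a + s *: v).
  by move=> sd; have := UO s s sd sd; rewrite scaler0 addr0.
case: fmax => e /= e0 fmax.
pose r := Num.min d e; have r0 : 0 < r by rewrite lt_min d0.
have h0 : 0 < r / 2 by rewrite divr_gt0.
have hr : r / 2 < r by lra.
have rd s : 0 <= s <= r / 2 -> `|s| < d.
  move=> /andP[s0 sr]; rewrite ger0_norm //.
  by rewrite (le_lt_trans sr) // (lt_le_trans hr) // ge_min lexx.
have [|c hc e1] := @MVT_line _ _ f a v _ h0.
  by move=> s /rd /UO [Os _]; exact: Ck_derivable (Ck_le cf) Os.
have [c0 cr] := andP hc.
have [|c' hc' e2] := @MVT_line _ _ ('D_v f) a v _ c0.
  move=> s /andP[s0 sc]; apply: (Ck_derivable (Ck_derive v cf)).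
  by apply: (UO s _).1; apply: rd; rewrite s0 (le_trans sc) ?ltW.
have [c'0 c'c] := andP hc'.
have : f (a + (r / 2) *: v) <= f a.
  apply: fmax; rewrite /= sub0r normrN ger0_norm ?ltW //.
  by rewrite (lt_le_trans hr) // ge_min lexx orbT.
move: e2; rewrite df0 subr0 => e2.
rewrite -subr_le0 e1 e2 leNgt => /negP; apply.
apply: (mulr_gt0 h0); apply: (mulr_gt0 c0).
apply: (UO c' _).2; apply: rd; rewrite (ltW c'0) /=.
exact: ltW (lt_trans c'c cr).
Qed.

End C2.

(** * The ring of smooth functions on an open set *)

Section SmoothFunctions.
Variables (R : realType) (V : normedModType R) (O : set V).
Hypothesis oO : open O.

(** Functions are made to vanish outside of [O], so that they form a ring in which
    equality only depends on the values on [O]. *)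
Record smooth_fun (oO : open O) := SmoothFun {
  sfun :> V -> R;
  sfun_smooth : smooth_on O sfun;
  sfun_out : forall x, ~ O x -> sfun x = 0 }.

Local Notation S := (smooth_fun oO).

HB.instance Definition _ := gen_eqMixin S.
HB.instance Definition _ := gen_choiceMixin S.

Lemma sfun_ext (f g : S) : (forall x, O x -> f x = g x) -> f = g.
Proof.
case: f g => [f sf f0] [g sg g0] /= fg.
have e : f = g.
  by apply/funext => x; have [/fg//|Ox] := pselect (O x); rewrite f0 ?g0.
by rewrite {}e in sf f0 *; congr SmoothFun; exact: Prop_irrelevance.
Qed.

Definition cut (f : V -> R) x := if x \in O then f x else 0.

Lemma cutE f x : O x -> cut f x = f x.
Proof. by rewrite /cut => Ox; rewrite mem_set. Qed.

Lemma cut_out f x : ~ O x -> cut f x = 0.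
Proof. by rewrite /cut => Ox; rewrite memNset. Qed.

Lemma cut_smooth f : smooth_on O f -> smooth_on O (cut f).
Proof. by move=> sf k; apply: Ck_ext (sf k) => // x Ox; rewrite cutE. Qed.

Definition smooth_restrict f (sf : smooth_on O f) : S :=
  SmoothFun oO (cut_smooth sf) (@cut_out f).

Lemma smooth_restrictE f (sf : smooth_on O f) x : O x -> smooth_restrict sf x = f x.
Proof. exact: cutE. Qed.

Lemma smooth_cst c : smooth_on O (cst c : V -> R).
Proof. by move=> k; exact: Ck_cst. Qed.

Lemma smooth_add (f g : S) : smooth_on O ((f : V -> R) + g).
Proof. by move=> k; apply: Ck_add => //; exact: sfun_smooth. Qed.

Lemma smooth_opp (f : S) : smooth_on O (- (f : V -> R)).
Proof. by move=> k; apply: Ck_opp => //; exact: sfun_smooth. Qed.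

Lemma smooth_mul (f g : S) : smooth_on O ((f : V -> R) * g).
Proof. by move=> k; apply: Ck_mul => //; exact: sfun_smooth. Qed.

Lemma smooth_derive v (f : S) : smooth_on O ('D_v f).
Proof. by move=> k; apply: Ck_derive; exact: sfun_smooth. Qed.

Definition sadd f g := smooth_restrict (smooth_add f g).
Definition sopp f := smooth_restrict (smooth_opp f).
Definition smul f g := smooth_restrict (smooth_mul f g).
Definition scst c := smooth_restrict (smooth_cst c).

Let addE f g x : O x -> sadd f g x = f x + g x. Proof. exact: cutE. Qed.
Let oppE f x : O x -> sopp f x = - f x. Proof. exact: cutE. Qed.
Let mulE f g x : O x -> smul f g x = f x * g x. Proof. exact: cutE. Qed.
Let cstE c x : O x -> scst c x = c. Proof. exact: cutE. Qed.

Let addA : associative sadd.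
Proof. by move=> f g h; apply: sfun_ext => x Ox; rewrite !addE // addrA. Qed.
Let addC : commutative sadd.
Proof. by move=> f g; apply: sfun_ext => x Ox; rewrite !addE // addrC. Qed.
Let add0 : left_id (scst 0) sadd.
Proof. by move=> f; apply: sfun_ext => x Ox; rewrite addE // cstE // add0r. Qed.
Let addN : left_inverse (scst 0) sopp sadd.
Proof. by move=> f; apply: sfun_ext => x Ox; rewrite addE // oppE // cstE // addNr. Qed.

HB.instance Definition _ := GRing.isZmodule.Build S addA addC add0 addN.

Let mulA : associative smul.
Proof. by move=> f g h; apply: sfun_ext => x Ox; rewrite !mulE // mulrA. Qed.
Let mulC : commutative smul.
Proof. by move=> f g; apply: sfun_ext => x Ox; rewrite !mulE // mulrC. Qed.
Let mul1 : left_id (scst 1) smul.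
Proof. by move=> f; apply: sfun_ext => x Ox; rewrite mulE // cstE // mul1r. Qed.
Let mulD : left_distributive smul +%R.
Proof. by move=> f g h; apply: sfun_ext => x Ox; rewrite !(mulE, addE) // mulrDl. Qed.

HB.instance Definition _ := GRing.Zmodule_isComPzRing.Build S mulA mulC mul1 mulD.

Lemma sfun_addE (f g : S) x : O x -> (f + g) x = f x + g x.
Proof. exact: cutE. Qed.
Lemma sfun_oppE (f : S) x : O x -> (- f) x = - f x.
Proof. exact: cutE. Qed.
Lemma sfun_mulE (f g : S) x : O x -> (f * g) x = f x * g x.
Proof. exact: cutE. Qed.
Lemma sfun_1E x : O x -> (1 : S) x = 1.
Proof. exact: cutE. Qed.

Section Eval.
Variables (a : V) (Oa : O a).
(* The membership of a in O is used, as it makes the evaluation unital. *)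
Definition sev (f : S) : R := let _ := Oa in f a.

Let sev_zmod : zmod_morphism sev.
Proof. by move=> f g; rewrite /sev sfun_addE // sfun_oppE. Qed.
HB.instance Definition _ := GRing.isZmodMorphism.Build S R sev sev_zmod.

Let sev_monoid : monoid_morphism sev.
Proof. by split=> [|f g]; rewrite /sev ?sfun_1E ?sfun_mulE. Qed.
HB.instance Definition _ := GRing.isMonoidMorphism.Build S R sev sev_monoid.
End Eval.

Definition sder v (f : S) : S := smooth_restrict (smooth_derive v f).

Lemma sder_val v f x : O x -> sder v f x = 'D_v f x.
Proof. exact: cutE. Qed.

Let derivable_sf (f : S) x v : O x -> derivable f x v.
Proof. exact: Ck_derivable (sfun_smooth f 1). Qed.

Let nearO x : O x -> \forall y \near x, O y.
Proof. by move=> Ox; exact: open_nbhs_nbhs. Qed.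

Let sderD v f g : sder v (f + g) = sder v f + sder v g.
Proof.
apply: sfun_ext => x Ox; rewrite sfun_addE // !sder_val //.
rewrite -deriveD; try exact: derivable_sf.
by apply: near_eq_derive; apply: filterS (nearO Ox) => y Oy; exact: sfun_addE.
Qed.

Let sderM v f g : sder v (f * g) = sder v f * g + f * sder v g.
Proof.
apply: sfun_ext => x Ox; rewrite sfun_addE // !sfun_mulE // !sder_val //.
rewrite addrC [X in _ = _ + X]mulrC -deriveM; try exact: derivable_sf.
by apply: near_eq_derive; apply: filterS (nearO Ox) => y Oy; exact: sfun_mulE.
Qed.

Definition dsmooth v : derivation S := Derivation (sderD v) (sderM v).

Lemma dsmoothE v (f : S) x : O x -> dsmooth v f x = 'D_v f x.
Proof. exact: cutE. Qed.

Lemma dsmoothC v w (f : S) : dsmooth v (dsmooth w f) = dsmooth w (dsmooth v f).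
Proof.
apply: sfun_ext => x Ox.
have e u u' : dsmooth u (dsmooth u' f) x = 'D_u ('D_u' f) x.
  transitivity ('D_u (dsmooth u' f) x); first exact: dsmoothE.
  apply: near_eq_derive; apply: filterS (nearO Ox) => y Oy; exact: dsmoothE.
rewrite [LHS]e [RHS]e; apply: (deriveC oO _ _ _ Ox); exact: sfun_smooth.
Qed.

Lemma smooth_fun_inv (f : S) : (forall x, O x -> f x != 0) ->
  exists g : S, g * f = 1.
Proof.
move=> f0.
have sg : smooth_on O (fun x => (f x)^-1).
  by move=> k; apply: Ck_inv => //; exact: sfun_smooth.
exists (smooth_restrict sg); apply: sfun_ext => x Ox.
by rewrite sfun_mulE // smooth_restrictE // sfun_1E // mulVf // f0.
Qed.

End SmoothFunctions.

(** * Linear algebra of the curvatures *)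

Section Triples.
Variable R : realType.
Implicit Types u v n a b c e : R * R * R.

Definition triple (v : 'rV[R]_3) : R * R * R :=
  (v 0 ord0, v 0 (lift ord0 ord0), v 0 (lift ord0 (lift ord0 ord0))).

Lemma dotE (v w : 'rV[R]_3) : dot v w = dot3 (triple v) (triple w).
Proof. by rewrite /dot !big_ord_recl big_ord0 addr0 /dot3 /= addrA. Qed.

Lemma dot3C u v : dot3 u v = dot3 v u.
Proof. by rewrite /dot3; ring. Qed.

Lemma triple_inj (v w : 'rV[R]_3) : triple v = triple w -> v = w.
Proof.
case=> h0 h1 h2; apply/rowP => i.
case: (unliftP ord0 i) => [j|] -> //; case: (unliftP ord0 j) => [k|] -> //.
by rewrite (ord1 k).
Qed.

(** Every unit normal [n] determines the cross product of the tangent vectors up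
    to a factor whose square is the Gram determinant, and whose sign depends on
    the orientation of the chart. *)
Lemma cross3_normal u v n : dot3 n n = 1 -> dot3 n u = 0 -> dot3 n v = 0 ->
  let c := dot3 n (cross3 u v) in
  cross3 u v = (c * n.1.1, c * n.1.2, c * n.2) /\ c ^+ 2 = gram u v.
Proof.
move=> nn nu nv c.
have cE : c ^+ 2 = dot3 n n * gram u v
   - dot3 n u * (dot3 n u * dot3 v v - dot3 n v * dot3 u v)
   - dot3 n v * (dot3 n v * dot3 u u - dot3 n u * dot3 u v).
  by rewrite /c /gram /dot3 /cross3 /=; ring.
split; last by rewrite cE nn nu nv; ring.
have e1 : (cross3 u v).1.1 * dot3 n n = c * n.1.1
   - dot3 n v * (n.1.2 * u.2 - n.2 * u.1.2) + dot3 n u * (n.1.2 * v.2 - n.2 * v.1.2).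
  by rewrite /c /dot3 /cross3 /=; ring.
have e2 : (cross3 u v).1.2 * dot3 n n = c * n.1.2
   - dot3 n v * (n.2 * u.1.1 - n.1.1 * u.2) + dot3 n u * (n.2 * v.1.1 - n.1.1 * v.2).
  by rewrite /c /dot3 /cross3 /=; ring.
have e3 : (cross3 u v).2 * dot3 n n = c * n.2
   - dot3 n v * (n.1.1 * u.1.2 - n.1.2 * u.1.1) + dot3 n u * (n.1.1 * v.1.2 - n.1.2 * v.1.1).
  by rewrite /c /dot3 /cross3 /=; ring.
move: e1 e2 e3; rewrite nn nu nv !mulr1 !mul0r !addr0 !subr0.
by case: (cross3 u v) => [[? ?] ?] /= -> -> ->.
Qed.

(** Passage from the unit normal to the unnormalised one. The factor [k] between
    them occurs in even powers only, and [k ^+ 2] is the Gram determinant. *)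
Lemma curvature_forms u v n a b c (l1 l2 : R) :
  dot3 n n = 1 -> dot3 n u = 0 -> dot3 n v = 0 -> 0 < gram u v ->
  - (dot3 v v * dot3 a n - 2 * dot3 u v * dot3 b n + dot3 u u * dot3 c n)
     = (l1 + l2) * gram u v ->
  dot3 a n * dot3 c n - dot3 b n ^+ 2 = l1 * l2 * gram u v ->
  let D := gram u v in let P := trII u v a b c in let Q := detII u v a b c in
  [/\ Q = l1 * l2 * D ^+ 2,
      l1 * l2 != 0 -> pinching l1 l2 = pinch P Q D D^-1 Q^-1
    & forall m : 'rV[R]_3, triple m = n ->
      let phi := (P ^+ 3 - 3 * P * Q * D) * D^-1 ^+ 5 in
      triple (- (l1 ^+ 3 + l2 ^+ 3) *: m) =
      (phi * (cross3 u v).1.1, phi * (cross3 u v).1.2, phi * (cross3 u v).2)].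
Proof.
move=> nn nu nv D0 hS hK D P Q.
have [nE c2] := cross3_normal nn nu nv; move: nE c2.
set k := dot3 n (cross3 u v) => nE k2.
have PE : P = - (k * (l1 + l2) * D).
  rewrite -mulrA -hS mulrN opprK /P /trII nE /dot3 /=; ring.
have QE : Q = l1 * l2 * D ^+ 2.
  have : Q = k ^+ 2 * (dot3 a n * dot3 c n - dot3 b n ^+ 2).
    by rewrite /Q /detII nE /dot3 /=; ring.
  by rewrite k2 hK => ->; rewrite -/D; ring.
have D0' : D != 0 by rewrite gt_eqF.
have k0 : k != 0.
  by apply: contraTneq D0 => k0; rewrite -k2 k0 expr0n ltxx.
split=> // [l0|m mn phi].
  have P2 : P ^+ 2 = D ^+ 3 * (l1 + l2) ^+ 2.
    by rewrite PE sqrrN !exprMn k2 -/D; ring.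
  rewrite /pinch P2 QE /pinching; field.
  by move: l0; rewrite mulf_eq0 negb_or D0' => /andP[-> ->].
have -> : phi = - (l1 ^+ 3 + l2 ^+ 3) / k.
  rewrite /phi PE QE /D -k2; field.
  by rewrite k0.
rewrite nE -mn /triple !mxE /=.
by congr (_, _, _); field.
Qed.

Lemma det_mx2 (B : 'M[R]_2) : \det B = B 0 0 * B 1 1 - B 0 1 * B 1 0.
Proof.
rewrite (expand_det_row _ ord0) !big_ord_recl big_ord0 /cofactor !det_mx11 !mxE /=.
have -> : lift ord0 ord0 = 1 :> 'I_2 by apply: val_inj.
have -> : lift 1 0 = 0 :> 'I_2 by apply: val_inj.
by rewrite expr0 expr1 addr0 mul1r mulN1r mulrN.
Qed.

Lemma char_poly2 (G h : 'M[R]_2) (l1 l2 : R) : G \in unitmx ->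
  char_poly (invmx G *m h) = ('X - l1%:P) * ('X - l2%:P) ->
  G 1 1 * h 0 0 - G 1 0 * h 0 1 - G 0 1 * h 1 0 + G 0 0 * h 1 1 =
    (l1 + l2) * (G 0 0 * G 1 1 - G 0 1 * G 1 0)
  /\ h 0 0 * h 1 1 - h 0 1 * h 1 0 = l1 * l2 * (G 0 0 * G 1 1 - G 0 1 * G 1 0).
Proof.
move=> uG; set B := invmx G *m h => cB.
have hE : h = G *m B by rewrite /B mulKVmx.
have o1 : lift ord0 ord0 = 1 :> 'I_2 by apply: val_inj.
have pE : ('X - l1%:P) * ('X - l2%:P) = 'X^2 - (l1 + l2) *: 'X + (l1 * l2)%:P :> {poly R}.
  by rewrite -mul_polyC polyCD polyCM; ring.
have trB : B 0 0 + B 1 1 = l1 + l2.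
  have := char_poly_trace B isT; rewrite cB pE.
  rewrite /mxtrace !big_ord_recl big_ord0 addr0 o1 !coefE /=.
  by rewrite mulr1 add0r addr0 => /oppr_inj.
have detB : B 0 0 * B 1 1 - B 0 1 * B 1 0 = l1 * l2.
  have := char_poly_det B; rewrite cB pE det_mx2 !coefE /=.
  by rewrite sqrrN expr1n mul1r mulr0 subr0 add0r => ->.
rewrite hE !mxE !big_ord_recl !big_ord0 !addr0 o1.
by rewrite -trB -detB; split; ring.
Qed.

Definition frame_coords e1 e2 e3 u : R * R * R := (dot3 u e1, dot3 u e2, dot3 u e3).

Section OrthonormalFrame.
Variables e1 e2 : R * R * R.
Hypotheses (n1 : dot3 e1 e1 = 1) (n2 : dot3 e2 e2 = 1) (o12 : dot3 e1 e2 = 0).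
Local Notation e3 := (cross3 e1 e2).
Local Notation co := (frame_coords e1 e2 e3).

(** This holds, like [frame_cross], modulo multiples of [dot3 e1 e1 - 1],
    [dot3 e2 e2 - 1] and [dot3 e1 e2], which are made explicit before the
    hypotheses on the frame are used. *)
Lemma frame_dot u v : dot3 (co u) (co v) = dot3 u v.
Proof.
transitivity (dot3 u v * (dot3 e1 e1 * dot3 e2 e2 - dot3 e1 e2 ^+ 2)
  + dot3 u e1 * dot3 v e1 * (1 - dot3 e2 e2)
  + dot3 u e2 * dot3 v e2 * (1 - dot3 e1 e1)
  + (dot3 u e1 * dot3 v e2 + dot3 u e2 * dot3 v e1) * dot3 e1 e2); last first.
  by rewrite n1 n2 o12; ring.
by rewrite /dot3 /frame_coords /cross3 /dot3 /=; ring.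
Qed.

Lemma frame_cross u v : cross3 (co u) (co v) = co (cross3 u v).
Proof.
have h1 : dot3 u e2 * dot3 v e3 - dot3 u e3 * dot3 v e2 =
    dot3 (cross3 u v) e1 * dot3 e2 e2 - dot3 (cross3 u v) e2 * dot3 e1 e2.
  by rewrite /dot3 /cross3 /=; ring.
have h2 : dot3 u e3 * dot3 v e1 - dot3 u e1 * dot3 v e3 =
    dot3 (cross3 u v) e2 * dot3 e1 e1 - dot3 (cross3 u v) e1 * dot3 e1 e2.
  by rewrite /dot3 /cross3 /=; ring.
have h3 : dot3 u e1 * dot3 v e2 - dot3 u e2 * dot3 v e1 = dot3 (cross3 u v) e3.
  by rewrite /dot3 /cross3 /=; ring.
rewrite {1}/cross3 /= h1 h2 h3 n1 n2 o12 /frame_coords.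
by rewrite !mulr1 !mulr0 !subr0.
Qed.

Lemma frame_gram u v : gram (co u) (co v) = gram u v.
Proof. by rewrite /gram !frame_dot. Qed.

Lemma frame_trII u v a b c :
  trII (co u) (co v) (co a) (co b) (co c) = trII u v a b c.
Proof. by rewrite /trII !frame_cross !frame_dot. Qed.

Lemma frame_detII u v a b c :
  detII (co u) (co v) (co a) (co b) (co c) = detII u v a b c.
Proof. by rewrite /detII !frame_cross !frame_dot. Qed.

End OrthonormalFrame.

(** The off-diagonal entry of a symmetric matrix after a rotation has this form in
    the cosine [c] and the sine [s]. *)
Lemma quadratic_angle (A B : R) : exists c s : R,
  c ^+ 2 + s ^+ 2 = 1 /\ A * (c ^+ 2 - s ^+ 2) + B * (c * s) = 0.
Proof.
have [->|A0] := eqVneq A 0; first by exists 1, 0; split; ring.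
(* t is the tangent of the angle: a root of t^2 = k t + 1. *)
pose k := B / A; pose t := (k + Num.sqrt (k ^+ 2 + 4)) / 2.
have t2 : t ^+ 2 = k * t + 1.
  have : Num.sqrt (k ^+ 2 + 4) ^+ 2 = k ^+ 2 + 4.
    by rewrite sqr_sqrtr // addr_ge0 ?sqr_ge0.
  rewrite /t; move: (Num.sqrt _) => r hr.
  by rewrite expr_div_n sqrrD hr; field.
have p0 : 0 < 1 + t ^+ 2 by rewrite ltr_pwDl ?sqr_ge0.
pose c : R := (Num.sqrt (1 + t ^+ 2))^-1.
have c2 : c ^+ 2 * (1 + t ^+ 2) = 1.
  by rewrite /c exprVn sqr_sqrtr ?ltW // mulVf // gt_eqF.
exists c, (t * c); split; first by rewrite -c2; ring.
have -> : A * (c ^+ 2 - (t * c) ^+ 2) + B * (c * (t * c)) =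
    A * c ^+ 2 * (1 - t ^+ 2 + k * t) by rewrite /k; field.
by rewrite t2; ring.
Qed.

(** Gram-Schmidt for the tangent vectors [u] and [v], followed by a rotation of the
    tangent plane that diagonalises the second fundamental form. *)
Lemma principal_frame u v a b c : 0 < gram u v -> exists e1 e2,
  let e3 := cross3 e1 e2 in
  [/\ dot3 e1 e1 = 1, dot3 e2 e2 = 1, dot3 e1 e2 = 0,
      dot3 u e3 = 0 /\ dot3 v e3 = 0 &
      - (dot3 v e1 * dot3 v e2) * dot3 a e3
      + (dot3 u e1 * dot3 v e2 + dot3 v e1 * dot3 u e2) * dot3 b e3
      - dot3 u e1 * dot3 u e2 * dot3 c e3 = 0].
Proof.
move=> D0.
have uu0 : 0 < dot3 u u.
  rewrite lt_neqAle eq_sym; apply/andP; split; last first.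
    by rewrite /dot3 -!expr2 !addr_ge0 ?sqr_ge0.
  by apply: contraTneq D0 => h; rewrite /gram h mul0r sub0r oppr_gt0 -leNgt sqr_ge0.
pose p := (Num.sqrt (dot3 u u))^-1.
pose q := (Num.sqrt (gram u v))^-1.
have p2 : p ^+ 2 * dot3 u u = 1.
  by rewrite /p exprVn sqr_sqrtr ?ltW // mulVf // gt_eqF.
have q2 : q ^+ 2 * gram u v = 1.
  by rewrite /q exprVn sqr_sqrtr ?ltW // mulVf // gt_eqF.
pose lin (x y : R) : R * R * R :=
  (x * u.1.1 + y * v.1.1, x * u.1.2 + y * v.1.2, x * u.2 + y * v.2).
pose E1 := lin p 0; pose E2 := lin (- (p * q * dot3 u v)) (p * q * dot3 u u).
have linE x y x' y' : dot3 (lin x y) (lin x' y') =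
    x * x' * dot3 u u + (x * y' + y * x') * dot3 u v + y * y' * dot3 v v.
  by rewrite /dot3 /=; ring.
have E11 : dot3 E1 E1 = 1 by rewrite linE -p2; ring.
have E12 : dot3 E1 E2 = 0 by rewrite linE; ring.
have E22 : dot3 E2 E2 = 1.
  have -> : dot3 E2 E2 = (p ^+ 2 * dot3 u u) * (q ^+ 2 * gram u v).
    by rewrite linE /gram; ring.
  by rewrite p2 q2 mulr1.
pose N := cross3 E1 E2.
have uN : dot3 u N = 0 by rewrite /N /E1 /E2 /lin /cross3 /dot3 /=; ring.
have vN : dot3 v N = 0 by rewrite /N /E1 /E2 /lin /cross3 /dot3 /=; ring.
have [co [si [cs e]]] := quadratic_angle
  (- (dot3 v E1 * dot3 v E2) * dot3 a N
      + (dot3 u E1 * dot3 v E2 + dot3 v E1 * dot3 u E2) * dot3 b N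
      - dot3 u E1 * dot3 u E2 * dot3 c N)
  ((dot3 v E1 ^+ 2 - dot3 v E2 ^+ 2) * dot3 a N
   - 2 * (dot3 u E1 * dot3 v E1 - dot3 u E2 * dot3 v E2) * dot3 b N
   + (dot3 u E1 ^+ 2 - dot3 u E2 ^+ 2) * dot3 c N).
pose rot (x y : R) : R * R * R :=
  (x * E1.1.1 + y * E2.1.1, x * E1.1.2 + y * E2.1.2, x * E1.2 + y * E2.2).
have rotE x y x' y' : dot3 (rot x y) (rot x' y') =
    x * x' * dot3 E1 E1 + (x * y' + y * x') * dot3 E1 E2 + y * y' * dot3 E2 E2.
  by rewrite /dot3 /=; ring.
have drot w x y : dot3 w (rot x y) = x * dot3 w E1 + y * dot3 w E2.
  by rewrite /dot3 /=; ring.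
have crot : cross3 (rot co si) (rot (- si) co) = N.
  transitivity ((co ^+ 2 + si ^+ 2) * N.1.1, (co ^+ 2 + si ^+ 2) * N.1.2,
    (co ^+ 2 + si ^+ 2) * N.2).
    by rewrite /N /cross3 /=; congr (_, _, _); ring.
  by rewrite cs !mul1r; case: (N) => -[].
exists (rot co si), (rot (- si) co); rewrite crot; split=> //.
- by rewrite rotE E11 E12 E22 -[RHS]cs; ring.
- by rewrite rotE E11 E12 E22 -[RHS]cs; ring.
- by rewrite rotE E11 E12 E22; ring.
by rewrite !drot -[RHS]e; ring.
Qed.

End Triples.

(** * Evolution at a spatial maximum *)

Section FormsMorphism.
Variables (A B : comPzRingType) (f : {rmorphism A -> B}).
Implicit Types u v a b c : A * A * A.

Definition map3 u : B * B * B := (f u.1.1, f u.1.2, f u.2).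

Lemma rmorph_dot3 u v : f (dot3 u v) = dot3 (map3 u) (map3 v).
Proof. by rewrite /dot3 !rmorphD !rmorphM. Qed.

Lemma map3_cross3 u v : map3 (cross3 u v) = cross3 (map3 u) (map3 v).
Proof. by rewrite /map3 /cross3 /= !rmorphB !rmorphM. Qed.

Lemma rmorph_gram u v : f (gram u v) = gram (map3 u) (map3 v).
Proof. by rewrite /gram rmorphB rmorphM rmorphXn !rmorph_dot3. Qed.

Lemma rmorph_trII u v a b c :
  f (trII u v a b c) = trII (map3 u) (map3 v) (map3 a) (map3 b) (map3 c).
Proof.
by rewrite /trII rmorphD rmorphB !rmorphM rmorph_nat !rmorph_dot3 !map3_cross3.
Qed.

Lemma rmorph_detII u v a b c :
  f (detII u v a b c) = detII (map3 u) (map3 v) (map3 a) (map3 b) (map3 c).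
Proof.
by rewrite /detII rmorphB rmorphM rmorphXn !rmorph_dot3 !map3_cross3.
Qed.
End FormsMorphism.

Section Jet.
Variables (R : realType) (V : normedModType R) (g : V -> 'rV[R]_3).
Variables w0 w1 w2 : V.

Definition jet1 v p := triple ('D_v g p).
Definition jet2 v w p := triple ('D_v ('D_w g) p).
Definition jgram p := gram (jet1 w1 p) (jet1 w2 p).
Definition jtr p :=
  trII (jet1 w1 p) (jet1 w2 p) (jet2 w1 w1 p) (jet2 w1 w2 p) (jet2 w2 w2 p).
Definition jdet p :=
  detII (jet1 w1 p) (jet1 w2 p) (jet2 w1 w1 p) (jet2 w1 w2 p) (jet2 w2 w2 p).
Definition jpinch p :=
  pinch (jtr p) (jdet p) (jgram p) (jgram p)^-1 (jdet p)^-1.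
(** The coefficient of the velocity with respect to the unnormalised normal. *)
Definition jspeed p :=
  (jtr p ^+ 3 - 3 * jtr p * jdet p * jgram p) * (jgram p)^-1 ^+ 5.
Definition jnormal p := cross3 (jet1 w1 p) (jet1 w2 p).
End Jet.

Lemma ev_comb2 (A : comPzRingType) (R : realFieldType) (ev : {rmorphism A -> R})
    (d dv dw : derivation A) (ca cb f : A) (al be : R) :
  (forall h, d h = ca * dv h + cb * dw h) ->
  dv ca = 0 -> dv cb = 0 -> dw ca = 0 -> dw cb = 0 -> dv (dw f) = dw (dv f) ->
  ev ca = al -> ev cb = be ->
  ev (d (d f)) = al ^+ 2 * ev (dv (dv f)) + 2 * al * be * ev (dv (dw f))
    + be ^+ 2 * ev (dw (dw f)).
Proof.
move=> dE va vb wa wb vw <- <-; rewrite !dE !(derD, derM) va vb wa wb -vw.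
by rewrite !(rmorphD, rmorphM) !rmorph0; ring.
Qed.

Section Functional.
Variables (R : realType) (V : normedModType R) (O : set V).
Hypothesis oO : open O.

Lemma derive_dot3 k (f : V -> 'rV[R]_3) e v p : Ck_on k.+1 O f -> O p ->
  'D_v (fun q => dot3 (triple (f q)) e) p = dot3 (triple ('D_v f p)) e.
Proof.
move=> cf Op; have d i : derivable (fun q => f q 0 i) p v.
  exact: (derivable_mxP _ _ _).1 (Ck_derivable cf Op) 0 i.
have dc (c : R) : derivable (cst c) p v by exact: derivable_cst.
have dm i c : derivable ((fun q => f q 0 i) * cst c) p v by apply: derivableM.
have -> : (fun q => dot3 (triple (f q)) e) =
    (fun q => f q 0 ord0) * cst e.1.1 + (fun q => f q 0 (lift ord0 ord0)) * cst e.1.2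
    + (fun q => f q 0 (lift ord0 (lift ord0 ord0))) * cst e.2.
  by apply/funext.
rewrite (deriveD (derivableD (dm _ _) (dm _ _)) (dm _ _)).
rewrite (deriveD (dm _ _) (dm _ _)) !(deriveM (d _) (dc _)) !derive_cst !scaler0 !add0r /dot3 /triple /=.
by rewrite !derive_coord; try exact: Ck_derivable cf Op;
  rewrite -![_ *: _]/(_ * _) ![e.1.1 * _]mulrC ![e.1.2 * _]mulrC ![e.2 * _]mulrC.
Qed.

Lemma Ck_dot3 k (f : V -> 'rV[R]_3) e : Ck_on k O f ->
  Ck_on k O (fun q => dot3 (triple (f q)) e).
Proof.
move=> cf; have cm i (c : R) : Ck_on k O ((fun q => f q 0 i) * cst c).
  by apply: Ck_mul => //; [exact: Ck_coord|exact: Ck_cst].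
exact: (Ck_add oO (Ck_add oO (cm ord0 e.1.1) (cm (lift ord0 ord0) e.1.2))
  (cm (lift ord0 (lift ord0 ord0)) e.2)).
Qed.

Lemma smooth_comb_derive (oO' : open O) (f : smooth_fun oO') (v w : V) (al be : R) :
  dsmooth oO' (al *: v + be *: w) f =
  scst oO' al * dsmooth oO' v f + scst oO' be * dsmooth oO' w f.
Proof.
apply: sfun_ext => x Ox; have c1 := sfun_smooth f 1.
rewrite sfun_addE // !sfun_mulE // !dsmoothE // (derive_dirD oO _ _ c1) //.
rewrite !derive_scale; try exact: Ck_derivable c1 Ox.
have cE c : scst oO' c x = c by exact: cutE.
by rewrite !cE.
Qed.

Lemma dsmooth_cst (oO' : open O) v c : dsmooth oO' v (scst oO' c) = 0.
Proof.
apply: sfun_ext => x Ox; rewrite dsmoothE //.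
have -> : 'D_v (scst oO' c) x = 'D_v (cst c) x.
  apply: near_eq_derive; apply: filterS (open_nbhs_nbhs (conj oO' Ox)) => y Oy.
  exact: cutE.
by rewrite derive_cst; apply/esym; exact: cutE.
Qed.

Lemma sev_comb2 (oO' : open O) (f : smooth_fun oO') (v w : V) (al be : R) x
    (Ox : O x) : let d := dsmooth oO' in let ev := sev (oO := oO') Ox in
  ev (d (al *: v + be *: w) (d (al *: v + be *: w) f)) =
  al ^+ 2 * ev (d v (d v f)) + 2 * al * be * ev (d v (d w f))
  + be ^+ 2 * ev (d w (d w f)).
Proof.
apply: (@ev_comb2 (smooth_fun oO') R (sev (oO := oO') Ox) _ _ _
  (scst oO' al) (scst oO' be)).
- by move=> h; exact: smooth_comb_derive.
- exact: dsmooth_cst.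
- exact: dsmooth_cst.
- exact: dsmooth_cst.
- exact: dsmooth_cst.
- exact: dsmoothC.
- exact: cutE.
- exact: cutE.
Qed.

End Functional.

Lemma frame_forms (A : comPzRingType) (R : realType) (f : {rmorphism A -> R})
    (e1 e2 : R * R * R) u v a b c u' v' a' b' c' :
  dot3 e1 e1 = 1 -> dot3 e2 e2 = 1 -> dot3 e1 e2 = 0 ->
  let co := frame_coords e1 e2 (cross3 e1 e2) in
  map3 f u = co u' -> map3 f v = co v' ->
  map3 f a = co a' -> map3 f b = co b' -> map3 f c = co c' ->
  [/\ f (gram u v) = gram u' v', f (trII u v a b c) = trII u' v' a' b' c' &
      f (detII u v a b c) = detII u' v' a' b' c'].
Proof.
move=> n1 n2 o12 co hu hv ha hb hc.
rewrite rmorph_gram rmorph_trII rmorph_detII hu hv ha hb hc.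
by rewrite frame_gram // frame_trII // frame_detII.
Qed.

Lemma ev_pinch (A : comPzRingType) (R : realFieldType) (f : {rmorphism A -> R})
    P Q D i k p q d : i * D = 1 -> k * Q = 1 -> f P = p -> f Q = q -> f D = d ->
  f (pinch P Q D i k) = pinch p q d d^-1 q^-1.
Proof.
move=> /(ev_inv f)[_ iE] /(ev_inv f)[_ kE] hP hQ hD.
by rewrite /pinch !(rmorphM, rmorphB, rmorphXn, rmorph_nat) iE kE hP hQ hD.
Qed.

Lemma ev_tangent_speed (A : comPzRingType) (R : realFieldType)
    (f : {rmorphism A -> R}) P Q D i p q d :
  i * D = 1 -> f P = p -> f Q = q -> f D = d ->
  f ((P ^+ 3 - 3 * P * Q * D) * i ^+ 5) = (p ^+ 3 - 3 * p * q * d) * d^-1 ^+ 5.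
Proof.
move=> /(ev_inv f)[_ iE] hP hQ hD.
by rewrite !(rmorphM, rmorphB, rmorphXn, rmorph_nat) iE hP hQ hD.
Qed.

Lemma dot3_scale (A : comPzRingType) (c : A) n e :
  dot3 (c * n.1.1, c * n.1.2, c * n.2) e = c * dot3 n e.
Proof. by rewrite /dot3 /=; ring. Qed.

Lemma rmorph_principal (A B : comPzRingType) (f : {rmorphism A -> B})
    x1 y1 x2 y2 z11 z12 z22 x1' y1' x2' y2' z11' z12' z22' :
  f x1 = x1' -> f y1 = y1' -> f x2 = x2' -> f y2 = y2' ->
  f z11 = z11' -> f z12 = z12' -> f z22 = z22' ->
  f (- (x2 * y2) * z11 + (x1 * y2 + x2 * y1) * z12 - x1 * y1 * z22) =
  - (x2' * y2') * z11' + (x1' * y2' + x2' * y1') * z12' - x1' * y1' * z22'.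
Proof.
by move=> <- <- <- <- <- <- <-; rewrite !(rmorphB, rmorphD, rmorphN, rmorphM).
Qed.

Lemma gram_planar (A : comPzRingType) (x1 y1 x2 y2 : A) :
  gram (x1, y1, 0) (x2, y2, 0) = (x1 * y2 - x2 * y1) ^+ 2.
Proof. by rewrite /gram /dot3 /=; ring. Qed.

Lemma near_line (R : realType) (V : normedModType R) (a v : V) (U : set V) :
  nbhs a U -> \forall s \near (0 : R), U (a + s *: v).
Proof.
have : (fun s : R => a + s *: v) @ (0 : R) --> a.
  rewrite -[X in _ --> X]addr0; apply: cvgD; first exact: cvg_cst.
  rewrite -(scale0r v); apply: cvgZr_tmp; exact: cvg_id.
by move=> h aU; exact: h.
Qed.

Section LocalMaximum.
Variables (R : realType) (V : normedModType R) (O : set V) (oO : open O).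
Variables (g : V -> 'rV[R]_3) (sg : smooth_on O g) (a : V) (Oa : O a).
Variables w0 w1 w2 : V.
Hypothesis gram_gt0 : forall p, O p -> 0 < jgram g w1 w2 p.
Hypothesis det_gt0 : forall p, O p -> 0 < jdet g w1 w2 p.
Hypothesis flow : forall p, O p -> jet1 g w0 p =
  (jspeed g w1 w2 p * (jnormal g w1 w2 p).1.1,
   jspeed g w1 w2 p * (jnormal g w1 w2 p).1.2,
   jspeed g w1 w2 p * (jnormal g w1 w2 p).2).
Hypothesis space_max : forall al be : R, \forall s \near (0 : R),
  jpinch g w1 w2 (a + s *: (al *: w1 + be *: w2)) <= jpinch g w1 w2 a.

(** The coordinates of the surface in a principal frame at [a] are smooth
    functions. On the open set where their Jacobian [J] does not vanish they
    satisfy the hypotheses of [chart_max_le0] in the ring of smooth functions. *)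
Lemma local_max : derivable (jpinch g w1 w2) a w0 /\ 'D_w0 (jpinch g w1 w2) a <= 0.
Proof.
have [e1 [e2 [n1 n2 o12 [z1 z2] princ]]] := principal_frame
  (jet2 g w1 w1 a) (jet2 g w1 w2 a) (jet2 g w2 w2 a) (gram_gt0 Oa).
set e3 := cross3 e1 e2 in z1 z2 princ.
pose L e (v : V) p := dot3 (jet1 g v p) e.
pose J p := L e1 w1 p * L e2 w2 p - L e1 w2 p * L e2 w1 p.
have cL e v : Ck_on 0 O (L e v) by apply: Ck_dot3 => //; apply: Ck_derive; exact: sg.
have cJ p : O p -> {for p, continuous J}.
  move=> Op; apply: cvgB; apply: cvgM; exact: (Ck_cont (cL _ _) Op).
pose O' := O `&` [set p | J p != 0].
have oO' : open O'.
  rewrite openE => p [Op /= Jp]; apply: filterI; first exact: open_nbhs_nbhs.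
  exact: (cvgr_neq0 _ (cJ p Op) Jp).
have sO p : O' p -> O p by case.
have J2 : J a ^+ 2 = jgram g w1 w2 a.
  have co1 : frame_coords e1 e2 e3 (jet1 g w1 a) = (L e1 w1 a, L e2 w1 a, 0).
    by congr (_, _, _); exact: z1.
  have co2 : frame_coords e1 e2 e3 (jet1 g w2 a) = (L e1 w2 a, L e2 w2 a, 0).
    by congr (_, _, _); exact: z2.
  transitivity (gram (frame_coords e1 e2 e3 (jet1 g w1 a))
    (frame_coords e1 e2 e3 (jet1 g w2 a))).
    by rewrite co1 co2 gram_planar.
  exact: (frame_gram n1 n2 o12).
have O'a : O' a.
  by split=> //=; rewrite -sqrf_eq0 J2 gt_eqF // gram_gt0.
have sg' k : Ck_on k O' g by apply: (Ck_sub _ (sg k)).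
have sX e : smooth_on O' (fun p => dot3 (triple (g p)) e).
  by move=> k; apply: Ck_dot3.
pose S : comPzRingType := smooth_fun oO'.
pose X e : S := smooth_restrict oO' (sX e).
pose d v : derivation S := dsmooth oO' v.
have d1E e v p : O' p -> d v (X e) p = dot3 (jet1 g v p) e.
  move=> Op; transitivity ('D_v (X e) p); first exact: dsmoothE.
  rewrite /jet1 -(derive_dot3 e v (sg' 1%N) Op).
  apply: near_eq_derive; apply: filterS (open_nbhs_nbhs (conj oO' Op)) => y Oy.
  exact: smooth_restrictE.
have d2E e v w p : O' p -> d v (d w (X e)) p = dot3 (jet2 g v w p) e.
  move=> Op; transitivity ('D_v (d w (X e)) p); first exact: dsmoothE.
  rewrite /jet2 -(derive_dot3 e v (Ck_derive w (sg' 2%N)) Op).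
  apply: near_eq_derive; apply: filterS (open_nbhs_nbhs (conj oO' Op)) => y Oy.
  exact: d1E.
pose evp p (Op : O' p) : {rmorphism S -> R} := sev (oO := oO') Op.
have ev1 v p (Op : O' p) :
    map3 (evp p Op) (d v (X e1), d v (X e2), d v (X e3)) =
    frame_coords e1 e2 e3 (jet1 g v p).
  by congr (_, _, _); exact: d1E.
have ev2 v w p (Op : O' p) :
    map3 (evp p Op) (d v (d w (X e1)), d v (d w (X e2)), d v (d w (X e3))) =
    frame_coords e1 e2 e3 (jet2 g v w p).
  by congr (_, _, _); exact: d2E.
pose X1 := (d w1 (X e1), d w1 (X e2), d w1 (X e3)).
pose X2 := (d w2 (X e1), d w2 (X e2), d w2 (X e3)).
pose X11 := (d w1 (d w1 (X e1)), d w1 (d w1 (X e2)), d w1 (d w1 (X e3))).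
pose X12 := (d w1 (d w2 (X e1)), d w1 (d w2 (X e2)), d w1 (d w2 (X e3))).
pose X22 := (d w2 (d w2 (X e1)), d w2 (d w2 (X e2)), d w2 (d w2 (X e3))).
pose D : S := gram X1 X2.
pose P : S := trII X1 X2 X11 X12 X22.
pose Q : S := detII X1 X2 X11 X12 X22.
have forms p (Op : O' p) := frame_forms n1 n2 o12
  (ev1 w1 p Op) (ev1 w2 p Op) (ev2 w1 w1 p Op) (ev2 w1 w2 p Op) (ev2 w2 w2 p Op).
have DE p (Op : O' p) : evp p Op D = jgram g w1 w2 p by case: (forms p Op).
have PE p (Op : O' p) : evp p Op P = jtr g w1 w2 p by case: (forms p Op).
have QE p (Op : O' p) : evp p Op Q = jdet g w1 w2 p by case: (forms p Op).
pose JS : S := d w1 (X e1) * d w2 (X e2) - d w2 (X e1) * d w1 (X e2).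
have JE p (Op : O' p) : evp p Op JS = J p.
  rewrite /JS rmorphB; congr (_ - _); rewrite rmorphM; congr (_ * _); exact: d1E.
have [j jJ] : exists j : S, j * JS = 1.
  apply: smooth_fun_inv => p Op; have : evp p Op JS != 0 by rewrite JE; case: Op.
  exact.
have [i iD] : exists i : S, i * D = 1.
  apply: smooth_fun_inv => p Op; have : evp p Op D != 0.
    by rewrite DE gt_eqF // gram_gt0 //; exact: sO.
  exact.
have [k kQ] : exists k : S, k * Q = 1.
  apply: smooth_fun_inv => p Op; have : evp p Op Q != 0.
    by rewrite QE gt_eqF // det_gt0 //; exact: sO.
  exact.
pose W : S := pinch P Q D i k.
have WE p (Op : O' p) : W p = jpinch g w1 w2 p.
  transitivity (evp p Op W); first by [].
  exact: ev_pinch iD kQ (PE p Op) (QE p Op) (DE p Op).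
have nearW : \forall p \near a, W p = jpinch g w1 w2 p.
  by apply: filterS (open_nbhs_nbhs (conj oO' O'a)) => p Op; exact: WE.
have dW v : derivable W a v by exact: Ck_derivable (sfun_smooth W 1) O'a.
split; first exact: near_eq_derivable nearW (dW w0).
have dv v (F : S) : evp a O'a (d v F) = 'D_v F a by exact: dsmoothE.
rewrite -(near_eq_derive _ nearW) -(dv w0 W).
have maxW al be : \forall s \near (0 : R), W (a + s *: (al *: w1 + be *: w2)) <= W a.
  have nearO' := near_line (al *: w1 + be *: w2) (open_nbhs_nbhs (conj oO' O'a)).
  near=> s.
  have Os : O' (a + s *: (al *: w1 + be *: w2)) by near: s.
  by rewrite (WE _ Os) (WE _ O'a); near: s; exact: space_max.
have max1 al be : evp a O'a (d (al *: w1 + be *: w2) W) = 0.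
  by rewrite dv (derive_max_eq0 oO' (sfun_smooth W 1) O'a (maxW al be)).
have max2 al be : evp a O'a
    (d (al *: w1 + be *: w2) (d (al *: w1 + be *: w2) W)) <= 0.
  move: (maxW al be); move: (al *: w1 + be *: w2) => v maxv.
  have -> : evp a O'a (d v (d v W)) = 'D_v ('D_v W) a.
    rewrite dv; apply: near_eq_derive.
    by apply: filterS (open_nbhs_nbhs (conj oO' O'a)) => p Op; exact: dsmoothE.
  exact: (derive2_max_le0 oO' (sfun_smooth W 2) O'a maxv).
have nE p (Op : O' p) : map3 (evp p Op) (cross3 X1 X2) =
    frame_coords e1 e2 e3 (jnormal g w1 w2 p).
  by rewrite map3_cross3 ev1 ev1; exact: frame_cross.
pose phi : S := (P ^+ 3 - 3 * P * Q * D) * i ^+ 5.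
have phiE p (Op : O' p) : evp p Op phi = jspeed g w1 w2 p.
  exact: ev_tangent_speed iD (PE p Op) (QE p Op) (DE p Op).
have flowS : (d w0 (X e1), d w0 (X e2), d w0 (X e3)) =
    (phi * (cross3 X1 X2).1.1, phi * (cross3 X1 X2).1.2, phi * (cross3 X1 X2).2).
  have fl e m : (forall p (Op : O' p), evp p Op m = dot3 (jnormal g w1 w2 p) e) ->
      d w0 (X e) = phi * m.
    move=> hm; apply: sfun_ext => p Op.
    transitivity (dot3 (jet1 g w0 p) e); first exact: d1E.
    transitivity (evp p Op (phi * m)); last by [].
    rewrite rmorphM phiE hm (flow (sO _ Op)).
    exact: dot3_scale.
  by congr (_, _, _); apply: fl => p Op; case: (nE p Op).
have d01 v w (F : S) : d v (d w F) = d w (d v F) by exact: dsmoothC.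
apply: (@chart_max_le0 S R (evp a O'a) (d w0) (d w1) (d w2)
  (X e1) (X e2) (X e3) i j k (d01 _ _) (d01 _ _) (d01 _ _) jJ iD kQ flowS).
- transitivity (dot3 (jet1 g w1 a) e3); [exact: d1E|exact: z1].
- transitivity (dot3 (jet1 g w2 a) e3); [exact: d1E|exact: z2].
- have q1 e v : evp a O'a (d v (X e)) = dot3 (jet1 g v a) e := d1E e v a O'a.
  have q2 v w : evp a O'a (d v (d w (X e3))) = dot3 (jet2 g v w a) e3 :=
    d2E e3 v w a O'a.
  exact: etrans (rmorph_principal (q1 e1 w1) (q1 e2 w1) (q1 e1 w2) (q1 e2 w2)
    (q2 w1 w1) (q2 w1 w2) (q2 w2 w2)) princ.
- by rewrite [X in 0 < X]QE; exact: det_gt0.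
- by have := max1 1 0; rewrite scale1r scale0r addr0.
- by have := max1 0 1; rewrite scale1r scale0r add0r.
move=> al be; apply: le_trans (max2 al be).
by rewrite le_eqVlt; apply/orP; left; apply/eqP/esym; exact: sev_comb2.
Unshelve. all: by end_near.
Qed.
End LocalMaximum.

(** * The maximum principle *)

Lemma derive_left_max_ge0 (R : realType) (f : R -> R) (c e : R) : 0 < e ->
  derivable f c 1 -> (forall h, 0 < h < e -> f (c - h) <= f c) -> 0 <= 'D_1 f c.
Proof.
move=> e0 df fmax; rewrite leNgt; apply/negP => D0.
have [/= d d0 dP] : \forall h \near (0 : R)^', h^-1 *: (f (h *: 1 + c) - f c) < 0.
  exact: (cvgr_lt _ df _ D0).
pose h := Num.min d e / 2.
have m0 : 0 < Num.min d e by rewrite lt_min d0.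
have h0 : 0 < h by rewrite divr_gt0.
have hm : h < Num.min d e by rewrite /h; move: m0; lra.
have /fmax fh : 0 < h < e by rewrite h0 (lt_le_trans hm) // ge_min lexx orbT.
have := dP (- h); rewrite /= sub0r opprK gtr0_norm // oppr_eq0 gt_eqF //.
rewrite (lt_le_trans hm) ?ge_min ?lexx // => /(_ isT isT).
rewrite (_ : - h *: 1 + c = c - h); last by rewrite [_ *: 1]mulr1 addrC.
rewrite ltNge => /negP; apply; apply: mulr_le0.
  by rewrite invr_le0 oppr_le0 ltW.
by rewrite subr_le0.
Qed.

Section MaximumPrinciple.
Variables (R : realType) (M : topologicalType) (T : \bar R) (W : R -> M -> R).
Hypotheses (M0 : [set: M] !=set0) (cM : compact [set: M]).
Hypothesis contW : forall t p, times T t ->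
  (fun z : R * M => W z.1 z.2) @ within [set z | times T z.1] (nbhs (t, p)) --> W t p.
Hypothesis decr_at_max : forall t p, 0 < t -> (t%:E < T)%E ->
  (forall q, W t q <= W t p) ->
  derivable (fun s => W s p) t 1 /\ 'D_1 (fun s => W s p) t <= 0.

Lemma max_on_interval (s t eps : R) : times T s -> times T t -> s <= t ->
  exists t0 p0, [/\ s <= t0, t0 <= t &
    forall r q, s <= r -> r <= t -> W r q - eps * r <= W t0 p0 - eps * t0].
Proof.
move=> [s0 sT] [_ tT] st; have [q0 _] := M0.
pose K : set (R * M) := `[s, t] `*` setT.
have cK : compact K by apply: compact_setX => //; exact: segment_compact.
have K0 : K !=set0 by exists (s, q0); split=> //=; rewrite in_itv /= lexx.
have KT r : r \in `[s, t] -> times T r.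
  rewrite in_itv /= => /andP[sr rt]; split; first exact: le_trans sr.
  by apply: le_lt_trans tT; rewrite lee_fin.
have cf : {within K, continuous (fun z : R * M => W z.1 z.2 - eps * z.1)}.
  apply/subspace_continuousP => -[r q] [/= rK _].
  apply: cvgB.
    move=> B hB.
    have h : \forall z \near (r, q), times T z.1 -> B (W z.1 z.2).
      exact: contW (KT r rK) B hB.
    have h2 : \forall z \near (r, q), K z -> B (W z.1 z.2).
      by apply: filterS h => z h [/KT tz _]; exact: h.
    exact: h2.
  apply: cvg_within_filter; apply: cvgM; first exact: cvg_cst.
  exact: cvg_fst.
have [[t0 p0] /set_mem[/= t0K _] hmax] := compact_EVT_max K0 cK cf.
exists t0, p0; move: t0K; rewrite in_itv /= => /andP[? ?]; split=> // r q sr rt.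
by apply: (hmax (r, q)); apply: mem_set; split=> //=; rewrite in_itv /= sr.
Qed.

(** If the maximum at time [t] exceeded the one at time [s], then half of the mean
    slope between them would be an [eps] for which [W - eps * r] attains its
    maximum over [s <= r <= t] after the time [s]. There [W] is maximal in space
    and its time derivative is at least [eps]. *)
Lemma maximum_principle : exists m : R -> R,
  (forall t, times T t -> is_max (W t) (m t)) /\
  (forall s t, times T s -> times T t -> s <= t -> m t <= m s).
Proof.
have exm t : exists m, times T t -> is_max (W t) m.
  have [tT|?] := pselect (times T t); last by exists 0.
  have [t0 [p0 [h1 h2 h]]] := max_on_interval 0 tT tT (lexx t).
  have e : t0 = t by apply/eqP; rewrite eq_le h1 h2.
  exists (W t p0) => _; split; first by exists p0.
  by move=> q; have := h t q (lexx t) (lexx t); rewrite !mul0r !subr0 e.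
have [m mP] := choice exm; exists m; split=> // s t sT tT st.
rewrite leNgt; apply/negP => ms.
have [[p1 p1t] _] := mP t tT; have [_ smax] := mP s sT.
have {}st : s < t.
  by rewrite lt_neqAle st andbT; apply: contraTneq ms => ->; rewrite ltxx.
pose eps := (m t - m s) / (2 * (t - s)).
have eps0 : 0 < eps by rewrite divr_gt0 ?mulr_gt0 // subr_gt0.
have epsE : eps * (t - s) = (m t - m s) / 2.
  by rewrite /eps; field; rewrite subr_eq0 gt_eqF.
have [t0 [p0 [st0 t0t hmax]]] := max_on_interval eps sT tT (ltW st).
have {}st0 : s < t0.
  rewrite lt_neqAle st0 andbT; apply/eqP => e.
  have := hmax t p1 (ltW st) (lexx t); rewrite -e p1t.
  have := smax p0; move: epsE; rewrite mulrBr; move: ms.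
  move: (eps * t) (eps * s) (W s p0) (m t) (m s) => a b c d f; lra.
have [s0 _] := sT.
have t00 : 0 < t0 by exact: le_lt_trans st0.
have t0T : (t0%:E < T)%E by case: tT => _; apply: le_lt_trans; rewrite lee_fin.
have [|dW dW0] := decr_at_max t00 t0T (p := p0).
  by move=> q; have := hmax t0 q (ltW st0) t0t; rewrite lerD2r.
pose lin : R -> R := cst eps * id.
have d1 : derivable (@id R) (t0 : R) (1 : R) by exact: derivable_id.
have d2 : derivable (cst eps : R -> R) (t0 : R) (1 : R) by exact: derivable_cst.
have de : derivable lin t0 1 := derivableM d2 d1.
have linE : 'D_1 lin t0 = eps.
  rewrite (deriveM d2 d1) derive_id derive_cst scaler0 addr0; exact: mulr1.
have h : 0 <= 'D_1 ((fun r => W r p0) - lin) t0.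
  apply: (@derive_left_max_ge0 R _ t0 (t0 - s)); first by rewrite subr_gt0.
    exact: derivableB dW de.
  move=> h /andP[h0 hs]; apply: hmax; first by rewrite lerBrDr -lerBrDl ltW.
  by rewrite (le_trans _ t0t) // gerBl ltW.
move: h; rewrite (deriveB dW de) linE.
by rewrite subr_ge0 => h; move: dW0 eps0; lra.
Qed.

End MaximumPrinciple.

(** * Curvatures in a chart *)

Lemma deriveC_rV (R : realType) (V : normedModType R) (O : set V) n
    (f : V -> 'rV[R]_n) a v w : open O -> Ck_on 2 O f -> O a ->
  'D_v ('D_w f) a = 'D_w ('D_v f) a.
Proof.
move=> oO cf Oa; have e u u' i : ('D_u ('D_u' f) a) 0 i =
    'D_u ('D_u' (fun y => f y 0 i)) a.
  rewrite -derive_coord; last exact: Ck_derivable (Ck_derive u' cf) Oa.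
  apply: near_eq_derive; apply: filterS (open_nbhs_nbhs (conj oO Oa)) => y Oy.
  by rewrite derive_coord //; exact: Ck_derivable (Ck_le cf) Oy.
apply/rowP => i; have := e w v i; have := e v w i.
have c : Ck_on 2 O (fun y => f y 0 i) by apply: Ck_coord.
have h : 'D_v ('D_w (fun y => f y 0 i)) a = 'D_w ('D_v (fun y => f y 0 i)) a.
  by apply: deriveC; [exact: oO|exact: c|exact: Oa].
move: ('D_v ('D_w f) a) ('D_w ('D_v f) a) => p q hp hq.
exact: etrans hp (etrans h (esym hq)).
Qed.

Lemma slice_derive (R : realType) (U W : normedModType R) (g : R * U -> W)
    (t : R) (u e : U) :
  'D_((0, e) : R * U) g (t, u) = 'D_e (fun v => g (t, v)) u.
Proof.
rewrite /derive.
set f1 := (fun h : R => _); set f2 := (fun h : R => _).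
suff -> : f1 = f2 by [].
apply/funext => h; rewrite /f1 /f2 /=.
congr (_ *: (g _ - _)).
by rewrite -[LHS]/(h *: 0 + t, h *: e + u) scaler0 add0r.
Qed.

Lemma row_free_gram_gt0 (R : realType) (J : 'M[R]_(2, 3)) :
  row_free J -> 0 < gram (triple (row 0 J)) (triple (row 1 J)).
Proof.
move=> fJ; set u := triple (row 0 J); set v := triple (row 1 J).
have gE : gram u v = dot3 (cross3 u v) (cross3 u v).
  by rewrite /gram /dot3 /cross3 /=; ring.
have sq (x : R * R * R) : 0 <= dot3 x x by rewrite /dot3 -!expr2 !addr_ge0 ?sqr_ge0.
have sq0 (x : R * R * R) : dot3 x x = 0 -> x = (0, 0, 0).
  case: x => -[x y] z; rewrite /dot3 /= -!expr2 => /eqP.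
  rewrite !paddr_eq0 ?addr_ge0 ?sqr_ge0 // !sqrf_eq0.
  by move=> /andP[/andP[/eqP-> /eqP->] /eqP->].
rewrite lt_neqAle gE sq andbT eq_sym -gE; apply/negP => /eqP g0.
have dep (al be : R) : (al * u.1.1 + be * v.1.1, al * u.1.2 + be * v.1.2,
    al * u.2 + be * v.2) = (0, 0, 0) -> al = 0 /\ be = 0.
  move=> h; pose c : 'rV[R]_2 := \row_k (if k == 0 then al else be).
  have : c *m J = 0.
    apply: triple_inj; rewrite [RHS](_ : _ = (0, 0, 0)); last first.
      by rewrite /triple !mxE.
    rewrite -h /triple /u /v /triple !mxE !big_ord_recl !big_ord0 !mxE /= !addr0.
    have -> : lift ord0 ord0 = 1 :> 'I_2 by apply: val_inj.
    by [].
  move/eqP; rewrite mulmx_free_eq0 // => /eqP/rowP c0.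
  by have := (c0 0, c0 1); rewrite !mxE /= => -[].
have [u0|u0] := eqVneq (dot3 u u) 0.
  have [] := dep 1 0; last by move=> /eqP; rewrite oner_eq0.
  by rewrite !mul1r !mul0r !addr0; exact: sq0 u0.
have [] := dep (- dot3 u v) (dot3 u u); last by move=> _ /eqP; rewrite (negPf u0).
apply: sq0; transitivity (dot3 u u * gram u v); last by rewrite g0 mulr0.
by rewrite /gram /dot3 /=; ring.
Qed.

Lemma first_formE (R : realType) (F : 'rV[R]_2 -> 'rV[R]_3) u a b :
  first_form F u a b = dot3 (triple (partial a F u)) (triple (partial b F u)).
Proof. by rewrite mxE dotE. Qed.

Lemma second_formE (R : realType) (F : 'rV[R]_2 -> 'rV[R]_3) n u a b :
  second_form F n u a b = - dot3 (triple (partial a (partial b F) u)) (triple n).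
Proof. by rewrite mxE dotE. Qed.

Lemma char_poly_forms (R : realType) (G h : 'M[R]_2) (l1 l2 : R)
    (u v n a b c : R * R * R) : 0 < gram u v ->
  G 0 0 = dot3 u u -> G 0 1 = dot3 u v -> G 1 0 = dot3 v u -> G 1 1 = dot3 v v ->
  h 0 0 = - dot3 a n -> h 0 1 = - dot3 b n -> h 1 0 = - dot3 b n ->
  h 1 1 = - dot3 c n ->
  char_poly (invmx G *m h) = ('X - l1%:P) * ('X - l2%:P) ->
  - (dot3 v v * dot3 a n - 2 * dot3 u v * dot3 b n + dot3 u u * dot3 c n)
     = (l1 + l2) * gram u v
  /\ dot3 a n * dot3 c n - dot3 b n ^+ 2 = l1 * l2 * gram u v.
Proof.
move=> D0 G00 G01 G10 G11 h00 h01 h10 h11 cE.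
have detG : \det G = gram u v.
  by rewrite det_mx2 G00 G01 G10 G11 (dot3C v u) /gram expr2.
have uG : G \in unitmx by rewrite unitmxE unitfE detG gt_eqF.
have [] := char_poly2 uG cE; rewrite -det_mx2 detG => hS hK.
rewrite -hS -hK G00 G01 G10 G11 h00 h01 h10 h11 (dot3C v u).
by split; ring.
Qed.

Section Chart.
Variables (R : realType) (M : topologicalType) (A : surface_atlas R M) (T : \bar R).
Variables (X : R -> M -> 'rV[R]_3) (nu : R -> M -> 'rV[R]_3) (l1 l2 : R -> M -> R).
Hypotheses
  (hemb : forall t, times T t -> embedding A (X t))
  (hnu : forall t p, times T t -> outer_unit_normal A (X t) p (nu t p))
  (hl : forall t p, times T t ->
      principal_curvatures A (X t) p (nu t p) (l1 t p) (l2 t p))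
  (hconvex : forall t p, times T t -> 0 < l1 t p /\ 0 < l2 t p).

Local Notation V := (R * 'rV[R]_2)%type.
Definition chart_dir (a : 'I_2) : V := (0, delta_mx 0 a).

Variables (i : idx A) (O : set V) (g : V -> 'rV[R]_3).
Hypotheses (oO : open O) (sg : smooth_on O g).
Let D := [set z : V | times T z.1 /\ dom i z.2].
Hypothesis gE : forall z, (D `&` O) z -> g z = X z.1 (par i z.2).
Variables (t : R) (u : 'rV[R]_2).
Hypothesis DOtu : (D `&` O) (t, u).

Local Notation F := (X t \o par i).
Local Notation e0 := (chart_dir 0).
Local Notation e1 := (chart_dir 1).

Let near_slice v : dom i v -> O (t, v) -> \forall v' \near v, dom i v' /\ O (t, v').
Proof.
move=> dv Ov.
have [[P Q] /= [Pt Qv] PQ] : nbhs ((t, v) : V) O by exact: open_nbhs_nbhs.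
have h' : nbhs v (dom i) by apply: open_nbhs_nbhs; split=> //; exact: dom_open.
apply: filterS2 h' Qv => v' dv' Qv'; split=> //; apply: (PQ (t, v')).
by split=> //=; exact: nbhs_singleton.
Qed.

Let tT : times T t. Proof. by case: DOtu => -[]. Qed.
Let du : dom i u. Proof. by case: DOtu => -[]. Qed.
Let Otu : O (t, u). Proof. by case: DOtu. Qed.

(** The extension [g] is smooth in space and time, also across the initial time.
    Its derivatives in the directions of the chart at a time of the flow are those
    of the surface, as they only depend on the values at that time. *)
Lemma slice_partial a v : dom i v -> O (t, v) ->
  'D_(chart_dir a) g (t, v) = partial a F v.
Proof.
move=> dv Ov; rewrite slice_derive; apply: near_eq_derive.
by apply: filterS (near_slice dv Ov) => v' [dv' Ov']; rewrite gE.
Qed.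

Lemma slice_partial2 a b :
  'D_(chart_dir a) ('D_(chart_dir b) g) (t, u) = partial a (partial b F) u.
Proof.
rewrite slice_derive; apply: near_eq_derive.
by apply: filterS (near_slice du Otu) => v [dv Ov]; rewrite slice_partial.
Qed.

(** The hypotheses on the flow at one point, in terms of the derivatives of the
    smooth function [g] only. *)
Lemma chart_forms : let p := par i u in
  [/\ 0 < jgram g e0 e1 (t, u), 0 < jdet g e0 e1 (t, u),
      pinching (l1 t p) (l2 t p) = jpinch g e0 e1 (t, u) &
      triple (- (l1 t p ^+ 3 + l2 t p ^+ 3) *: nu t p) =
      (jspeed g e0 e1 (t, u) * (jnormal g e0 e1 (t, u)).1.1,
       jspeed g e0 e1 (t, u) * (jnormal g e0 e1 (t, u)).1.2,
       jspeed g e0 e1 (t, u) * (jnormal g e0 e1 (t, u)).2)].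
Proof.
move=> p; have [nn nX _] := hnu p tT.
have [L1 L2] := hconvex p tT.
have j1 a : triple (partial a F u) = jet1 g (chart_dir a) (t, u).
  by rewrite /jet1 slice_partial.
have j2 a b : triple (partial a (partial b F) u) =
    jet2 g (chart_dir a) (chart_dir b) (t, u).
  by rewrite /jet2 slice_partial2.
have C2 : Ck_on 2 O g by exact: sg.
have j2C : triple (partial 1 (partial 0 F) u) = jet2 g e0 e1 (t, u).
  transitivity (jet2 g e1 e0 (t, u)); first exact: j2.
  exact: (congr1 (@triple R) (@deriveC_rV R V O 3 g (t, u) e1 e0 oO C2 Otu)).
have G0 : 0 < jgram g e0 e1 (t, u).
  have [_ /(_ i u du)/row_free_gram_gt0] := hemb tT.
  have r a : triple (row a (jacobian_mx F u)) = jet1 g (chart_dir a) (t, u).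
    exact: etrans (congr1 (@triple R) (rowK _ _)) (j1 a).
  by rewrite (r 0) (r 1).
have GE a b : first_form F u a b =
    dot3 (jet1 g (chart_dir a) (t, u)) (jet1 g (chart_dir b) (t, u)).
  by rewrite first_formE (j1 a) (j1 b).
have hE a b w : triple (partial a (partial b F) u) = w ->
    second_form F (nu t p) u a b = - dot3 w (triple (nu t p)).
  by move=> <-; exact: second_formE.
have [hS hK] := char_poly_forms G0 (GE 0 0) (GE 0 1) (GE 1 0) (GE 1 1)
  (hE 0 0 _ (j2 0 0)) (hE 0 1 _ (j2 0 1)) (hE 1 0 _ j2C) (hE 1 1 _ (j2 1 1))
  (hl tT du erefl).
have n0 a : dot3 (triple (nu t p)) (jet1 g (chart_dir a) (t, u)) = 0.
  by rewrite -(nX i u du erefl a) dotE; congr dot3; apply/esym/j1.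
have nn1 : dot3 (triple (nu t p)) (triple (nu t p)) = 1 by rewrite -dotE.
have [] := curvature_forms nn1 (n0 0) (n0 1) G0 hS hK.
move=> QE pE nE; have L12 : 0 < l1 t p * l2 t p by exact: mulr_gt0.
split; [exact: G0| |exact: pE (lt0r_neq0 L12)|exact: nE].
have Q0 : 0 < l1 t p * l2 t p * jgram g e0 e1 (t, u) ^+ 2.
  exact: mulr_gt0 L12 (exprn_gt0 2 G0).
exact: (eq_ind_r (fun x => 0 < x) Q0 QE).
Qed.

End Chart.

(** * Continuity and evolution of the pinching quantity *)

Section JetContinuity.
Variables (R : realType) (V : topologicalType) (z : V).
Local Notation cont f := {for z, continuous (f : V -> R)}.
Implicit Types (h k : V -> R) (f g a b c : V -> R * R * R).

Let contM h k : cont h -> cont k -> cont (fun y => h y * k y).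
Proof. exact: cvgM. Qed.

Let contB h k : cont h -> cont k -> cont (fun y => h y - k y).
Proof. exact: cvgB. Qed.

Let contD h k : cont h -> cont k -> cont (fun y => h y + k y).
Proof. exact: cvgD. Qed.

Let contc (x : R) : cont (fun=> x). Proof. exact: cvg_cst. Qed.

Let contX n h : cont h -> cont (fun y => h y ^+ n).
Proof.
move=> ch; elim: n => [|n IHn]; first exact: contc.
rewrite (_ : (fun y => h y ^+ n.+1) = (fun y => h y * h y ^+ n)); first exact: contM.
by apply/funext => y; rewrite exprS.
Qed.

Definition continuous3 f :=
  [/\ cont (fun y => (f y).1.1), cont (fun y => (f y).1.2) & cont (fun y => (f y).2)].

Let cont_dot3 f g : continuous3 f -> continuous3 g ->
  cont (fun y => dot3 (f y) (g y)).
Proof.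
by move=> [f1 f2 f3] [g1 g2 g3]; exact: contD (contD (contM f1 g1) (contM f2 g2)) (contM f3 g3).
Qed.

Let cont_cross3 f g : continuous3 f -> continuous3 g ->
  continuous3 (fun y => cross3 (f y) (g y)).
Proof.
by move=> [f1 f2 f3] [g1 g2 g3]; split;
  [exact: contB (contM f2 g3) (contM f3 g2)|exact: contB (contM f3 g1) (contM f1 g3)
  |exact: contB (contM f1 g2) (contM f2 g1)].
Qed.

Lemma continuous_gram f g : continuous3 f -> continuous3 g ->
  cont (fun y => gram (f y) (g y)).
Proof.
move=> cf cg; exact: contB (contM (cont_dot3 cf cf) (cont_dot3 cg cg))
  (contX (n := 2) (cont_dot3 cf cg)).
Qed.

Lemma continuous_trII f g a b c : continuous3 f -> continuous3 g ->
  continuous3 a -> continuous3 b -> continuous3 c ->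
  cont (fun y => trII (f y) (g y) (a y) (b y) (c y)).
Proof.
move=> cf cg ca cb cc; have cn := cont_cross3 cf cg.
exact: contD (contB (contM (cont_dot3 cg cg) (cont_dot3 cn ca))
  (contM (contM (contc (x := 2)) (cont_dot3 cf cg)) (cont_dot3 cn cb)))
  (contM (cont_dot3 cf cf) (cont_dot3 cn cc)).
Qed.

Lemma continuous_detII f g a b c : continuous3 f -> continuous3 g ->
  continuous3 a -> continuous3 b -> continuous3 c ->
  cont (fun y => detII (f y) (g y) (a y) (b y) (c y)).
Proof.
move=> cf cg ca cb cc; have cn := cont_cross3 cf cg.
exact: contB (contM (cont_dot3 cn ca) (cont_dot3 cn cc)) (contX (n := 2) (cont_dot3 cn cb)).
Qed.

Lemma continuous_pinch (P Q D : V -> R) : cont P -> cont Q -> cont D ->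
  D z != 0 -> Q z != 0 ->
  cont (fun y => pinch (P y) (Q y) (D y) (D y)^-1 (Q y)^-1).
Proof.
move=> cP cQ cD D0 Q0.
have cI : cont (fun y => (D y)^-1) by exact: cvgV.
have cK : cont (fun y => (Q y)^-1) by exact: cvgV.
have cQD := contM (contM (contc (x := 4)) cQ) cD.
exact: contM (contM (contM (contB (contM (contc (x := 3)) (contX (n := 2) cP)) cQD)
  (contB (contX (n := 2) cP) cQD)) (contX (n := 4) cI)) cK.
Qed.
End JetContinuity.

Lemma jpinch_continuous (R : realType) (V : normedModType R) (O : set V)
    (g : V -> 'rV[R]_3) w1 w2 z : open O -> Ck_on 2 O g -> O z ->
  jgram g w1 w2 z != 0 -> jdet g w1 w2 z != 0 ->
  {for z, continuous (jpinch g w1 w2)}.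
Proof.
move=> oO cg Oz G0 D0.
have tr (f : V -> 'rV[R]_3) : Ck_on 0 O f -> continuous3 z (fun y => triple (f y)).
  by move=> cf; split; exact: Ck_cont (Ck_coord _ oO cf) Oz.
have t1 w : continuous3 z (jet1 g w) by apply: tr; exact: Ck_derive (Ck_le cg).
have t2 v w : continuous3 z (jet2 g v w).
  by apply: tr; exact: Ck_derive (Ck_derive w cg).
apply: continuous_pinch G0 D0.
- exact: continuous_trII.
- exact: continuous_detII.
- exact: continuous_gram.
Qed.

Lemma time_slice (R : realType) (U : normedModType R) (f : R * U -> R) (t : R) u :
  (fun h : R => h^-1 *: (((fun s : R => f (s, u)) \o shift t) (h *: (1 : R)) - f (t, u))) =
  (fun h : R => h^-1 *: ((f \o shift (t, u)) (h *: ((1, 0) : R * U)) - f (t, u))).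
Proof.
apply/funext => h /=; congr (_ *: (f _ - _)).
by rewrite -[RHS]/(h *: 1 + t, h *: 0 + u) scaler0 add0r.
Qed.

Lemma times_nbhs (R : realType) (T : \bar R) (t : R) : 0 < t -> (t%:E < T)%E ->
  \forall s \near t, times T s.
Proof.
move=> t0 tT.
have h0 : \forall s \near t, 0 < s by exact: lt_nbhsr.
have hT : \forall s \near t, (s%:E < T)%E.
  case: T tT => [r||] tT; last by rewrite ltNge leNye in tT.
    by move: tT; rewrite lte_fin => tr; exact: lt_nbhsl.
  by near=> s; rewrite ltry.
by apply: filterS2 h0 hT => s s0 sT; split=> //; exact: ltW.
Unshelve. all: by end_near. Qed.

Lemma time_derivative (R : realType) (T : \bar R) (U : normedModType R)
    (g : R * U -> 'rV[R]_3) (O : set (R * U)) (c : R -> 'rV[R]_3) t u v :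
  open O -> O (t, u) -> (forall s, O (s, u) -> times T s /\ g (s, u) = c s) ->
  is_time_derivative T c t v -> 'D_((1, 0) : R * U) g (t, u) = v.
Proof.
move=> oO Ou gc cv; apply: cvg_lim => //.
have nO : \forall h \near (0 : R), O (t + h, u).
  have [[P Q] /= [Pt Qu] PQ] : nbhs ((t, u) : R * U) O by exact: open_nbhs_nbhs.
  have : \forall h \near (0 : R), P (t + h).
    have ct : (fun h : R => t + h) @ (0 : R) --> t.
      rewrite -[X in _ --> X]addr0; apply: cvgD; [exact: cvg_cst|exact: cvg_id].
    exact: ct.
  apply: filterS => h Ph; apply: (PQ (t + h, u)); split=> //.
  exact: nbhs_singleton.
move=> B vB; have h1 := cv B vB.
have h2 : \forall h \near (0 : R)^', times T (t + h) ->
    B (h^-1 *: (c (t + h) - c t)) by exact: h1.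
have nO' : \forall h \near (0 : R)^', O (t + h, u) by exact: cvg_within.
have h3 : \forall h \near (0 : R)^',
    B (h^-1 *: ((g \o shift (t, u)) (h *: ((1, 0) : R * U)) - g (t, u))).
  apply: filterS2 nO' h2 => h Oh; have [th gh] := gc _ Oh => /(_ th).
  have -> : (g \o shift (t, u)) (h *: ((1, 0) : R * U)) = c (t + h).
    rewrite -gh /=; congr (g _).
    by rewrite -[LHS]/(h *: 1 + t, h *: 0 + u) scaler0 add0r [_ *: 1]mulr1 addrC.
  by have [_ ->] := gc _ Ou.
exact: h3.
Qed.

Section Evolution.
Variables (R : realType) (M : topologicalType) (A : surface_atlas R M) (T : \bar R).
Variables (X : R -> M -> 'rV[R]_3) (nu : R -> M -> 'rV[R]_3) (l1 l2 : R -> M -> R).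
Hypotheses (hsmooth : smooth_family A T X)
  (hemb : forall t, times T t -> embedding A (X t))
  (hnu : forall t p, times T t -> outer_unit_normal A (X t) p (nu t p))
  (hl : forall t p, times T t ->
      principal_curvatures A (X t) p (nu t p) (l1 t p) (l2 t p))
  (hconvex : forall t p, times T t -> 0 < l1 t p /\ 0 < l2 t p)
  (hflow : forall t p, times T t ->
      is_time_derivative T (fun s => X s p) t
        (- (l1 t p ^+ 3 + l2 t p ^+ 3) *: nu t p)).

Local Notation V := (R * 'rV[R]_2)%type.
Local Notation W t p := (pinching (l1 t p) (l2 t p)).
Let D (i : idx A) := [set z : V | times T z.1 /\ dom i z.2].

(** In a chart the pinching quantity is a rational function of the derivatives of a
    local extension of the surface, which is smooth across the time [0]. *)
Lemma pinching_continuous t p : times T t ->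
  (fun z : R * M => W z.1 z.2) @ within [set z | times T z.1] (nbhs (t, p)) --> W t p.
Proof.
move=> tT; have [i [u du up]] := atlas_cover A p.
have Du : D i (t, u) by [].
have [ O [g [oO Ou sg gE]]] := hsmooth Du.
have gE' (z : V) : (D i `&` O) z -> g z = X z.1 (par i z.2) by move=> h; apply/gE.
have chart z := chart_forms hemb hnu hl hconvex oO sg gE' (t := z.1) (u := z.2).
have [G0 D0 WE _] := chart (t, u) (conj Du Ou).
have cW := jpinch_continuous oO (sg 2) Ou (lt0r_neq0 G0) (lt0r_neq0 D0).
move=> B; rewrite -up WE => /cW hB.
have [[P Q] /= [Pt Qu] PQ] : nbhs ((t, u) : V)
    (fun z => O z /\ B (jpinch g (chart_dir R 0) (chart_dir R 1) z)).
  by apply: filterI => //; exact: open_nbhs_nbhs.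
have pI : (par i @` dom i) p by exists u.
have nI : nbhs p (par i @` dom i) by apply: open_nbhs_nbhs; split=> //; exact: img_open.
have nQ : nbhs p (fun q => Q (Defs.coord i q)).
  by apply: (Defs.coord_continuous pI); rewrite -up parK.
have nP : nbhs t P by [].
have h : \forall z \near (t, par i u), times T z.1 -> B (W z.1 z.2).
  exists (P, fun q => (par i @` dom i) q /\ Q (Defs.coord i q)).
    by split=> //=; rewrite up; exact: filterI.
  move=> [s q] /= [Ps [[v dv vq]]]; rewrite -vq parK // => Qv sT.
  have [Osv Bsv] := PQ (s, v) (conj Ps Qv).
  by have [_ _ -> _] := chart (s, v) (conj (conj sT dv) Osv).
exact: h.
Qed.

(** At a positive time the extension agrees with the surface on a whole
    neighbourhood in space and time, so that [local_max] applies. *)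
Lemma pinching_decr_at_max t p : 0 < t -> (t%:E < T)%E ->
  (forall q, W t q <= W t p) ->
  derivable (fun s => W s p) t 1 /\ 'D_1 (fun s => W s p) t <= 0.
Proof.
move=> t0 tT Wmax; have [i [u du up]] := atlas_cover A p.
have tT' : times T t by split=> //; exact: ltW.
have Du : D i (t, u) by [].
have [ O [g [oO Ou sg gE]]] := hsmooth Du.
pose O' := O `&` interior (D i).
have oO' : open O' by apply: openI => //; exact: open_interior.
have sub z : O' z -> (D i `&` O) z by move=> [? /interior_subset].
have O'u : O' (t, u).
  split=> //; exists (times T, dom i); last by move=> [s v] [].
  split; first exact: times_nbhs.
  by apply: open_nbhs_nbhs; split=> //; exact: dom_open.
have sg' : smooth_on O' g by move=> k; apply: Ck_sub (sg k) => z [].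
have gE' (z : V) : (D i `&` O') z -> g z = X z.1 (par i z.2).
  by move=> [_ /sub h]; exact: gE h.
have chart s v (Osv : O' (s, v)) := chart_forms hemb hnu hl hconvex oO' sg' gE'
  (conj (sub _ Osv).1 Osv).
pose e0 : V := chart_dir R 0; pose e1 : V := chart_dir R 1.
pose w0 : V := (1, 0).
have G0 z : O' z -> 0 < jgram g e0 e1 z by case: z => s v /chart[].
have D0 z : O' z -> 0 < jdet g e0 e1 z by case: z => s v /chart[].
have flow z : O' z -> jet1 g w0 z =
    (jspeed g e0 e1 z * (jnormal g e0 e1 z).1.1,
     jspeed g e0 e1 z * (jnormal g e0 e1 z).1.2,
     jspeed g e0 e1 z * (jnormal g e0 e1 z).2).
  case: z => s v Osv; have [_ _ _ <-] := chart s v Osv.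
  have [[sT dv] _] := sub _ Osv.
  congr (@triple R _); apply: (time_derivative oO' Osv _ (hflow (p := par i v) sT)).
  by move=> r Orv; have [[rT _] _] := sub _ Orv; split=> //;
    rewrite (gE' (r, v) (conj (sub _ Orv).1 Orv)).
have WE s v : O' (s, v) -> jpinch g e0 e1 (s, v) = W s (par i v).
  by move=> /chart[_ _ ->].
have space_max al be : \forall s \near (0 : R),
    jpinch g e0 e1 ((t, u) + s *: (al *: e0 + be *: e1)) <= jpinch g e0 e1 (t, u).
  have := near_line (al *: e0 + be *: e1) (open_nbhs_nbhs (conj oO' O'u)).
  apply: filterS => s; set z := (_ + _ : V).
  have z1 : z.1 = t.
    rewrite -[LHS]/(t + s *: (al *: (0 : R) + be *: (0 : R))).
    by rewrite !scaler0 addr0 scaler0 addr0.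
  move: z1; case: z => r v /= -> Ov.
  by rewrite (WE _ _ Ov) (WE _ _ O'u) up; exact: Wmax.
have [dJ DJ] := local_max oO' sg' O'u G0 D0 flow space_max.
have nW : \forall s \near t, jpinch g e0 e1 (s, u) = W s p.
  have [[P Q] /= [Pt Qu] PQ] : nbhs ((t, u) : V) O' by exact: open_nbhs_nbhs.
  apply: filterS Pt => s Ps; rewrite WE ?up //.
  by apply: (PQ (s, u)); split=> //; exact: nbhs_singleton.
have dS : derivable (fun s => jpinch g e0 e1 (s, u)) t 1.
  by rewrite /derivable time_slice; exact: dJ.
split; first exact: near_eq_derivable nW dS.
by rewrite -(near_eq_derive _ nW) /derive time_slice; exact: DJ.
Qed.
End Evolution.

Unset Implicit Arguments.
Set Strict Implicit.

Theorem theorem9p2 (R : realType) (M : topologicalType) (A : surface_atlas R M)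
    (T : \bar R) (X : R -> M -> 'rV[R]_3) (nu : R -> M -> 'rV[R]_3)
    (l1 l2 : R -> M -> R)
    (hM : closed_surface M)
    (hT : (0 < T)%E)
    (hsmooth : smooth_family A T X)
    (hemb : forall t, times T t -> embedding A (X t))
    (hnu : forall t p, times T t -> outer_unit_normal A (X t) p (nu t p))
    (hl : forall t p, times T t ->
      principal_curvatures A (X t) p (nu t p) (l1 t p) (l2 t p))
    (hconvex : forall t p, times T t -> 0 < l1 t p /\ 0 < l2 t p)
    (hflow : forall t p, times T t ->
      is_time_derivative T (fun s => X s p) t
        (- (l1 t p ^+ 3 + l2 t p ^+ 3) *: nu t p)) :
  exists m : R -> R,
    (forall t, times T t -> is_max (fun p => pinching (l1 t p) (l2 t p)) (m t)) /\
    (forall s t, times T s -> times T t -> s <= t -> m t <= m s).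
Proof.
have [M0 _ cM _] := hM.
apply: (@maximum_principle R M T (fun t p => pinching (l1 t p) (l2 t p)) M0 cM).
  by move=> t p tT; exact: (pinching_continuous hsmooth hemb hnu hl hconvex tT).
move=> t p t0 tT Wmax.
exact: (pinching_decr_at_max hsmooth hemb hnu hl hconvex hflow t0 tT Wmax).
Qed.
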